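(* Let $d\ge 1$ and let $U:\mathbb{R}^d\to\mathbb{R}^+$ be a $C^1$ function with $\int_{\mathbb{R}^d} e^{-U(\mathbf{x})}\,d\mathbf{x}<\infty$, and let $\pi(d\mathbf{x})\propto e^{-U(\mathbf{x})}d\mathbf{x}$. For any constant $\lambda^{\mathrm{ref}}>0$, the Coordinate Sampler piecewise deterministic Markov process $(\mathbf{X}_t,\mathbf{V}_t)_{t\ge 0}$ on $\mathbb{R}^d\times\mathcal{V}$ (defined in the context) admits $\rho(d\mathbf{x},d\mathbf{v})=\pi(d\mathbf{x})\varphi(d\mathbf{v})$ as an invariant distribution, and this invariant distribution is unique.
   Context: Let $e_1,\dots,e_d$ be the standard basis of $\mathbb{R}^d$ and $\mathcal{V}=\{\pm e_i: i=1,\dots,d\}$ (a set of $2d$ velocities); $\varphi$ denotes the uniform distribution on $\mathcal{V}$. For $a\in\mathbb{R}$ write $a_+=\max(a,0)$. The Coordinate Sampler is the piecewise deterministic Markov process $\mathbf{Z}_t=(\mathbf{X}_t,\mathbf{V}_t)$ on $\mathbb{R}^d\times\mathcal{V}$ with the following three ingredients: (i) Deterministic dynamic between events: $\frac{d\mathbf{X}_t}{dt}=\mathbf{V}_t$, $\frac{d\mathbf{V}_t}{dt}=0$ (so the position moves linearly along a single coordinate direction). (ii) Event rate: events occur as an inhomogeneous Poisson process with rate $\lambda(\mathbf{X}_t,\mathbf{V}_t)$, where $\lambda(\mathbf{x},\mathbf{v})=\langle \mathbf{v},\nabla U(\mathbf{x})\rangle_+ +\lambda^{\mathrm{ref}}$.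 (iii) Transition at an event time with pre-event state $(\mathbf{x},\mathbf{v})$: the position is unchanged and the new velocity is $\mathbf{v}^*\in\mathcal{V}$ with probability $\lambda(\mathbf{x},-\mathbf{v}^* )/\lambda(\mathbf{x})$, where $\lambda(\mathbf{x})=\sum_{\mathbf{w}\in\mathcal{V}}\lambda(\mathbf{x},\mathbf{w})=2d\lambda^{\mathrm{ref}}+\sum_{i=1}^d\left|\frac{\partial U(\mathbf{x})}{\partial x_i}\right|$. That is, $Q((d\mathbf{x}',d\mathbf{v}')\mid(\mathbf{x},\mathbf{v}))=\sum_{\mathbf{v}^*\in\mathcal{V}}\frac{\lambda(\mathbf{x},-\mathbf{v}^* )}{\lambda(\mathbf{x})}\delta_{\mathbf{x}}(d\mathbf{x}')\delta_{\mathbf{v}^*}(d\mathbf{v}')$. *)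

(* Defs.v *)
From HB Require Import structures.
From mathcomp Require Import all_boot all_order all_algebra.
From mathcomp Require Import all_classical all_reals all_analysis.

Set Implicit Arguments.
Unset Strict Implicit.
Unset Printing Implicit Defensive.

Import Order.TTheory GRing.Theory Num.Theory.
Import numFieldNormedType.Exports.
Local Open Scope classical_set_scope.
Local Open Scope ring_scope.

Section CoordinateSampler.
Variables (R : realType) (d : nat).

(* positions: row vectors 'rV[R]_d ; velocities: +/- e_i encoded as (i, b),
   b = true meaning +e_i, b = false meaning -e_i *)
Definition vel := ('I_d * bool)%type.

Definition vsign (v : vel) : R := if v.2 then 1 else -1.

Definition vvec (v : vel) : 'rV[R]_d := vsign v *: delta_mx 0 v.1.

Definition vopp (v : vel) : vel := (v.1, ~~ v.2).

Definition ebasis (i : 'I_d) : 'rV[R]_d := delta_mx 0 i.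

Definition partialU (U : 'rV[R]_d -> R) (i : 'I_d) (x : 'rV[R]_d) : R :=
  'D_(ebasis i) U x.

Definition C1 (U : 'rV[R]_d -> R) : Prop :=
  (forall i x, derivable U x (ebasis i)) /\
  (forall i, continuous (partialU U i)).

(* event rate lambda(x,v) = <v, grad U(x)>_+ + lref *)
Definition rate (U : 'rV[R]_d -> R) (lref : R) (x : 'rV[R]_d) (v : vel) : R :=
  Num.max (vsign v * partialU U v.1 x) 0 + lref.

Definition total_rate U lref (x : 'rV[R]_d) : R := \sum_(w : vel) rate U lref x w.

(* Markov kernel Q applied to a function g: at an event at position x the new
   velocity is w with probability lambda(x,-w)/lambda(x); it does not depend
   on the pre-event velocity. *)
Definition Qop U lref (g : 'rV[R]_d * vel -> R) (x : 'rV[R]_d) : R :=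
  \sum_(w : vel) (rate U lref x (vopp w) / total_rate U lref x) * g (x, w).

Definition Lambda U lref (x : 'rV[R]_d) (v : vel) (s : R) : R :=
  fine (\int[lebesgue_measure]_(r in `[0, s]) (rate U lref (x + r *: vvec v) v)%:E).

Definition itv0 (t : R) : set R := `[0, t].

Definition BorelRd := g_sigma_algebraType (@open 'rV[R]_d).

Definition testfun (f : 'rV[R]_d * vel -> R) : Prop :=
  (exists M : R, forall z, 0 <= f z <= M) /\
  (forall v, measurable_fun setT (fun x : BorelRd => f (x, v))).

(* Transition semigroup of the Coordinate Sampler PDMP (Davis' characterization):
   P t f is the (nonnegative, bounded by sup f) solution of the renewal equation
     P_t f(x,v) = f(x+tv,v) exp(-Lambda_t)
        + int_0^t lambda(x+sv,v) exp(-Lambda_s) (Q P_{t-s} f)(x+sv) ds. *)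
Definition CS_semigroup (U : 'rV[R]_d -> R) (lref : R)
    (P : R -> ('rV[R]_d * vel -> R) -> ('rV[R]_d * vel -> R)) : Prop :=
  forall (t : R) (f : 'rV[R]_d * vel -> R), 0 <= t -> testfun f ->
    testfun (P t f) /\
    (forall M, (forall z, f z <= M) -> forall z, P t f z <= M) /\
    (forall (x : 'rV[R]_d) (v : vel),
      (P t f (x, v))%:E =
        (f (x + t *: vvec v, v) * expR (- Lambda U lref x v t))%:E
      + \int[lebesgue_measure]_(s in itv0 t)
          (rate U lref (x + s *: vvec v) v * expR (- Lambda U lref x v s)
           * Qop U lref (P (t - s) f) (x + s *: vvec v))%:E)%E.

End CoordinateSampler.

(* iterated Lebesgue integral over R^n (equals the Lebesgue integral on R^n
   for nonnegative measurable integrands, by Tonelli) *)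
Fixpoint intRn (R : realType) (n : nat) : ('rV[R]_n -> \bar R) -> \bar R :=
  match n return ('rV[R]_n -> \bar R) -> \bar R with
  | 0 => fun f => f 0
  | n'.+1 => fun f =>
      (\int[(@lebesgue_measure R)]_a
          intRn (fun y : 'rV[R]_n' => f (row_mx (const_mx a : 'rV[R]_1) y)))%E
  end.

Definition Zconst (R : realType) (d : nat) (U : 'rV[R]_d -> R) : R :=
  fine (intRn (fun x => (expR (- U x))%:E)).

(* integral of a nonnegative g against rho = pi (x) phi,
   pi(dx) = exp(-U(x)) dx / Z, phi uniform on the 2d velocities *)
Definition rho_int (R : realType) (d : nat) (U : 'rV[R]_d -> R)
    (g : 'rV[R]_d * vel d -> R) : \bar R :=
  (((2 * d)%:R * Zconst U)^-1)%:E *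
  (\sum_(v : vel d) intRn (fun x => (g (x, v) * expR (- U x))%:E))%E.

(* Main.v *)
(* Velocities have norm at most 1, so P_t f(x, v) depends only on data in the
   ball of radius t around x, where the event rate is bounded; the renewal
   equation is therefore solved by monotone iteration, and its bounded solution
   is unique.

   Invariance: along the flow, e^-U changes at rate -<v, grad U>, which equals
   lambda(x,-v) - lambda(x,v). Multiplying the renewal equation by e^-U turns it
   into a balance with the reversed rates lambda(x,-v). Integrating over x and
   translating along the flow, the gain and loss terms summed over v cancel,
   since the total flux into all velocities equals the total flux out of them
   under the reversed rates. This needs finite fluxes, hence first f with bounded
   support, then a monotone limit.

   Uniqueness: for two invariant probabilities with difference p - n (mutually
   singular, p carried by H), invariance forces P_t 1_H = 1 p-almost everywhere
   and P_t 1_H = 0 n-almost everywhere. If p <> 0, take a starting point of each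
   kind. As lref > 0, every velocity can be chosen at every time, so the two
   trajectories can be steered, coordinate by coordinate, to a common state; it
   would lie both in H and outside H. *)
Require Import Defs.
From HB Require Import structures.
From mathcomp Require Import all_boot all_order all_algebra.
From mathcomp Require Import all_classical all_reals all_analysis.
From mathcomp Require Import measurable_realfun finmap ring lra.
Set Implicit Arguments.
Unset Strict Implicit.
Unset Printing Implicit Defensive.
Import Order.TTheory GRing.Theory Num.Theory.
Import numFieldNormedType.Exports.
Local Open Scope classical_set_scope.
Local Open Scope ring_scope.

(** * Borel measurability on row vectors *)

(** Three obstacles shape the argument. For a given semigroup, [P t f] is known to be measurable in
    the position at each fixed time only, so the time integral in the renewal equation may have a
    nonmeasurable integrand; uniqueness therefore treats it as a lower integral and compares [P]
    with one jointly measurable solution. Infinite quantities of the extended reals cannot be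
    cancelled, so identities are kept additive, with nonnegative terms on both sides. Finally, a
    vanishing expectation controls jump times only up to null sets, while the two steered
    trajectories must meet exactly: only the difference of their durations is prescribed, and the
    durations themselves range over a window of positive length. Unequal durations leave unequal
    remaining times, which the last leg has to compensate. Conservation of mass, P_t f + P_t (1 - f)
    = 1, is a further consequence of uniqueness; it turns P_t 1_H = 1 into a vanishing
    expectation. *)

Lemma measurable_continuous_rV (R : realType) (n : nat) (f : 'rV[R]_n -> R) :
  continuous f -> measurable_fun setT (f : BorelRd R n -> R).
Proof.
move=> /continuousP cf; apply: (measurability _ (RGenOpens.measurableE R)).
move=> _ [_ [a [b ->] <-]]; rewrite setTI; apply: sub_sigma_algebra.
exact/cf/interval_open.
Qed.

Lemma measurable_coord (R : realType) (n : nat) (i : 'I_n) :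
  measurable_fun setT (fun x : BorelRd R n => (x : 'rV[R]_n) 0 i).
Proof. by apply: measurable_continuous_rV; exact: coord_continuous. Qed.

(* The rational boxes contained in an open set cover it. *)
Lemma measurable_fun_rV (R : realType) (n : nat) d (T : measurableType d)
    (phi : T -> BorelRd R n) :
  (forall i, measurable_fun setT (fun t => (phi t : 'rV[R]_n) 0 i)) ->
  measurable_fun setT phi.
Proof.
move=> mphi; apply: (@measurability _ _ T (BorelRd R n) setT phi (@open 'rV[R]_n)) => //.
move=> _ [W oW <-]; rewrite setTI.
pose B (p : 'rV[rat]_n * rat) : set 'rV[R]_n :=
  [set x | forall i, `|x 0 i - ratr (p.1 0 i)| < ratr p.2].
have -> : phi @^-1` W =
    \bigcup_p (if `[< B p `<=` W >] then phi @^-1` (B p) else set0).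
  apply/seteqP; split => [t Wt|t [p _]]; last by case: asboolP => // BW /BW.
  have : nbhs (phi t : 'rV[R]_n) W by exact: open_nbhs_nbhs.
  move=> /nbhs_ballP[e /= e0 eW].
  (* Points of the box lie within [2 r] of [phi t], hence the bound [e / 2]. *)
  have [r /andP[r0 re]] : exists r : rat, (0 : R) < ratr r < e / 2.
    have /rat_in_itvoo[q] : (0 : R) < e / 2 by rewrite divr_gt0.
    by rewrite in_itv/= => qe; exists q.
  have hq i : exists q : rat, `|(phi t : 'rV[R]_n) 0 i - ratr q| < ratr r.
    set x := (phi t : 'rV[R]_n) 0 i.
    have /rat_in_itvoo[q] : x - ratr r < x + ratr r.
      by rewrite ltrBlDr -addrA ltrDl addr_gt0.
    rewrite in_itv/= => /andP[xq qx]; exists q.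
    by rewrite ltr_norml; apply/andP; split; lra.
  pose q := \row_i xget 0 [set q : rat | `|(phi t : 'rV[R]_n) 0 i - ratr q| < ratr r].
  have qP i : `|(phi t : 'rV[R]_n) 0 i - ratr (q 0 i)| < ratr r.
    by rewrite mxE; case: xgetP => [y _ //|]; have [y yP] := hq i => /(_ y).
  exists (q, r) => //; rewrite asboolT//= => y By; apply: eW.
  split => // j i; rewrite (ord1 j) /ball /=.
  have := By i; have := qP i => /= h1 h2.
  rewrite [X in `|X|](_ : _ = ((phi t : 'rV[R]_n) 0 i - ratr (q 0 i)) -
     (y 0 i - ratr (q 0 i))); last by ring.
  rewrite (le_lt_trans (ler_normB _ _))// (lt_le_trans (ltrD h1 h2))//.
  lra.
apply: countable_bigcupT_measurable; first exact: countableP.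
move=> p; case: asboolP => _ //.
have -> : phi @^-1` B p = \bigcap_(i in [set: 'I_n])
    ((fun t => `|(phi t : 'rV[R]_n) 0 i - ratr (p.1 0 i)|) @^-1` `]-oo, ratr p.2[).
  apply/seteqP; split => [t Bt i _|t Bt i] /=.
    by rewrite in_itv/= Bt.
  by have := Bt i Logic.I; rewrite /= in_itv.
apply: fin_bigcap_measurable; first exact: finite_finset.
move=> i _; rewrite -[X in measurable X]setTI.
have mf : measurable_fun setT
    (fun t => `|(phi t : 'rV[R]_n) 0 i - ratr (p.1 0 i)|).
  by apply: measurableT_comp => //; exact: measurable_funB.
exact: mf.
Qed.

Lemma measurable_row_mx (R : realType) (n : nat) :
  measurable_fun setT (fun z : measurableTypeR R * BorelRd R n =>
    (row_mx (const_mx z.1 : 'rV[R]_1) z.2 : BorelRd R n.+1)).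
Proof.
apply: measurable_fun_rV => i; rewrite -(splitK (i : 'I_(1 + n))); case: (fintype.split _) => j /=.
  rewrite (_ : (fun t => _) = fst) //; apply/funext => t.
  by rewrite (row_mxEl (const_mx t.1 : 'rV[R]_1)) mxE.
rewrite (_ : (fun t => _) = (fun t => (t.2 : 'rV[R]_n) 0 j)); last first.
  by apply/funext => t; rewrite (row_mxEr (const_mx t.1 : 'rV[R]_1)).
exact: (measurableT_comp (measurable_coord j)).
Qed.

(** * The iterated Lebesgue integral *)

Section intRn_theory.
Context {R : realType}.
Local Open Scope ereal_scope.

Lemma intRn_ge0 (n : nat) (f : 'rV[R]_n -> \bar R) :
  (forall x, 0 <= f x) -> 0 <= intRn f.
Proof.
by elim: n f => [f f0|n IH f f0] //=; apply: integral_ge0 => a _; exact: IH.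
Qed.

(** Tonelli with a parameter. The parameter space is generalized in the induction, because the
    outermost coordinate joins the parameter before the remaining ones are integrated. *)
Lemma measurable_intRn (n : nat) d (T : measurableType d)
    (F : T -> 'rV[R]_n -> \bar R) :
  measurable_fun setT (fun z : T * BorelRd R n => F z.1 z.2) ->
  (forall t x, 0 <= F t x) ->
  measurable_fun setT (fun t => intRn (F t)).
Proof.
elim: n d T F => [|n IH] d T F mF F0 /=.
  exact: (measurable_fun_pair1 (f := fun z : T * BorelRd R 0 => F z.1 z.2)).
pose G (z : T * measurableTypeR R) :=
  intRn (fun y : 'rV[R]_n => F z.1 (row_mx (const_mx z.2 : 'rV[R]_1) y)).
have mG : measurable_fun setT G.
  apply: IH => //=.
  apply: (measurableT_comp (f := fun z : T * BorelRd R n.+1 => F z.1 z.2)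
    (g := fun z : T * measurableTypeR R * BorelRd R n =>
     (z.1.1, row_mx (const_mx z.1.2 : 'rV[R]_1) z.2 : BorelRd R n.+1))) => //.
  apply: measurable_fun_pair => /=.
    exact: measurableT_comp.
  apply: (measurableT_comp (@measurable_row_mx R n)
    (g := fun z : T * measurableTypeR R * BorelRd R n => (z.1.2, z.2))).
  apply: measurable_fun_pair => //=.
  exact: measurableT_comp.
by apply: (measurable_fun_fubini_tonelli_F (m2 := lebesgue_measure) G) => // z; exact: intRn_ge0.
Qed.

Lemma measurable_slice (n : nat) (f : BorelRd R n.+1 -> \bar R) a :
  measurable_fun setT f ->
  measurable_fun setT (fun y : BorelRd R n => f (row_mx (const_mx a : 'rV[R]_1) y)).
Proof.
move=> mf; apply: (measurableT_comp mf).
exact: (measurable_fun_pair2 _ (@measurable_row_mx R n)).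
Qed.

Lemma measurable_intRn_slice (n : nat) (f : BorelRd R n.+1 -> \bar R) :
  measurable_fun setT f -> (forall x, 0 <= f x) ->
  measurable_fun setT (fun a : measurableTypeR R =>
    intRn (fun y : 'rV[R]_n => f (row_mx (const_mx a : 'rV[R]_1) y))).
Proof.
move=> mf f0; apply: (measurable_intRn (F := fun a y => f (row_mx (const_mx a : 'rV[R]_1) y))) => //.
exact: (measurableT_comp mf (@measurable_row_mx R n)).
Qed.

Lemma eq_intRn (n : nat) (f g : 'rV[R]_n -> \bar R) :
  f =1 g -> intRn f = intRn g.
Proof. by move=> /funext ->. Qed.

Lemma le_intRn (n : nat) (f g : 'rV[R]_n -> \bar R) :
  measurable_fun setT (f : BorelRd R n -> _) ->
  measurable_fun setT (g : BorelRd R n -> _) ->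
  (forall x, 0 <= f x) -> (forall x, f x <= g x) ->
  intRn f <= intRn g.
Proof.
elim: n f g => [|n IH] f g mf mg f0 fg //=.
have g0 x : 0 <= g x by apply: le_trans (fg x).
apply: ge0_le_integral => //.
- by move=> a _; exact: intRn_ge0.
- exact: measurable_intRn_slice.
- exact: measurable_intRn_slice.
- by move=> a _; apply: IH => //; exact: measurable_slice.
Qed.

Lemma intRnD (n : nat) (f g : 'rV[R]_n -> \bar R) :
  measurable_fun setT (f : BorelRd R n -> _) ->
  measurable_fun setT (g : BorelRd R n -> _) ->
  (forall x, 0 <= f x) -> (forall x, 0 <= g x) ->
  intRn (fun x => f x + g x) = intRn f + intRn g.
Proof.
elim: n f g => [|n IH] f g mf mg f0 g0 //=.
rewrite -ge0_integralD//.
- by apply: eq_integral => a _; apply: IH => //; exact: measurable_slice.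
- by move=> a _; exact: intRn_ge0.
- exact: measurable_intRn_slice.
- by move=> a _; exact: intRn_ge0.
- exact: measurable_intRn_slice.
Qed.

Lemma intRnZl (n : nat) (k : R) (f : 'rV[R]_n -> \bar R) :
  (0 <= k)%R -> measurable_fun setT (f : BorelRd R n -> _) ->
  (forall x, 0 <= f x) ->
  intRn (fun x => k%:E * f x) = k%:E * intRn f.
Proof.
move=> k0; elim: n f => [|n IH] f mf f0 //=.
rewrite -ge0_integralZl_EFin//.
- by apply: eq_integral => a _; apply: IH => //; exact: measurable_slice.
- by move=> a _; exact: intRn_ge0.
- exact: measurable_intRn_slice.
Qed.

Lemma intRn0 (n : nat) : intRn (fun _ : 'rV[R]_n => 0) = 0.
Proof.
elim: n => [//|n IH] /=; under eq_integral do rewrite IH.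
exact: integral0.
Qed.

Lemma intRn_sum (n : nat) (I : Type) (r : seq I) (f : I -> 'rV[R]_n -> \bar R) :
  (forall i, measurable_fun setT (f i : BorelRd R n -> _)) ->
  (forall i x, 0 <= f i x) ->
  intRn (fun x => \sum_(i <- r) f i x) = \sum_(i <- r) intRn (f i).
Proof.
move=> mf f0; elim: r => [|i r IH].
  rewrite big_nil -[RHS](intRn0 n); apply: eq_intRn => x.
  by rewrite big_nil.
rewrite big_cons -IH -intRnD//.
- by apply: eq_intRn => x; rewrite big_cons.
- exact: emeasurable_sum.
- by move=> x; apply: sume_ge0.
Qed.

Lemma cvg_intRn (n : nat) (f : nat -> 'rV[R]_n -> \bar R) :
  (forall k, measurable_fun setT (f k : BorelRd R n -> _)) ->
  (forall k x, 0 <= f k x) ->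
  (forall x, nondecreasing_seq (f ^~ x)) ->
  intRn (f k) @[k --> \oo] --> intRn (fun x => limn (f ^~ x)).
Proof.
elim: n f => [|n IH] f mf f0 ndf /=; first exact: ereal_nondecreasing_is_cvgn.
rewrite (_ : (fun a => _) = (fun a => limn (fun k => intRn (fun y : 'rV[R]_n =>
    f k (row_mx (const_mx a : 'rV[R]_1) y))))); last first.
  apply/funext => a; apply/esym/cvg_lim => //.
  apply: (IH (fun k y => f k (row_mx (const_mx a : 'rV[R]_1) y))) => //.
  by move=> k; exact: measurable_slice.
apply: cvg_monotone_convergence => //.
- by move=> k; exact: measurable_intRn_slice.
- by move=> k a _; exact: intRn_ge0.
- move=> a _ k l kl; apply: le_intRn => //; try exact: measurable_slice.
  by move=> x; exact: ndf.
Qed.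

Lemma intRn_fubini (n : nat) d (T : measurableType d)
    (m : {sigma_finite_measure set T -> \bar R})
    (F : T -> 'rV[R]_n -> \bar R) :
  measurable_fun setT (fun z : T * BorelRd R n => F z.1 z.2) ->
  (forall t x, 0 <= F t x) ->
  \int[m]_t intRn (F t) = intRn (fun x => \int[m]_t F t x).
Proof.
elim: n F => [//|n IH] F mF F0 /=.
have mG : measurable_fun setT (fun z : T * measurableTypeR R * BorelRd R n =>
    F z.1.1 (row_mx (const_mx z.1.2 : 'rV[R]_1) z.2)).
  apply: (measurableT_comp (f := fun z : T * BorelRd R n.+1 => F z.1 z.2)
    (g := fun z : T * measurableTypeR R * BorelRd R n =>
     (z.1.1, row_mx (const_mx z.1.2 : 'rV[R]_1) z.2 : BorelRd R n.+1))) => //.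
  apply: measurable_fun_pair => /=; first exact: measurableT_comp.
  apply: (measurableT_comp (@measurable_row_mx R n)
    (g := fun z : T * measurableTypeR R * BorelRd R n => (z.1.2, z.2))).
  by apply: measurable_fun_pair => //=; exact: measurableT_comp.
pose G (z : T * measurableTypeR R) :=
  intRn (fun y : 'rV[R]_n => F z.1 (row_mx (const_mx z.2 : 'rV[R]_1) y)).
have mG' : measurable_fun setT G.
  exact: (measurable_intRn (F := fun (z : T * measurableTypeR R) y =>
     F z.1 (row_mx (const_mx z.2 : 'rV[R]_1) y))).
rewrite (fubini_tonelli (m1 := m) (m2 := lebesgue_measure) G)//; last first.
  by move=> z; exact: intRn_ge0.
apply: eq_integral => a _; rewrite /G/=.
apply: (IH (fun t y => F t (row_mx (const_mx a : 'rV[R]_1) y))) => //.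
apply: (measurableT_comp mG (g := fun z : T * BorelRd R n => ((z.1, a), z.2))).
apply: measurable_fun_pair => //=.
exact: measurable_fun_pair.
Qed.

(** The image of Lebesgue measure under a translation gives half-open intervals their length, hence
    is Lebesgue measure itself. *)
Lemma lebesgue_integral_shift (f : R -> \bar R) c :
  measurable_fun setT f -> (forall x, 0 <= f x) ->
  \int[lebesgue_measure]_x f (x + c)%R = \int[lebesgue_measure]_x f x.
Proof.
move=> mf f0.
have mc : measurable_fun setT ((fun x => x + c)%R : measurableTypeR R -> measurableTypeR R).
  exact: measurable_funD.
transitivity (\int[pushforward lebesgue_measure ((fun x => x + c)%R : measurableTypeR R -> measurableTypeR R)]_x f x).
  by rewrite ge0_integral_pushforward.
apply: eq_measure_integral => A mA _; apply/esym/lebesgue_measure_unique => //= _ [[a b]] _ <-.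
rewrite /pushforward.
rewrite (_ : _ @^-1` _ = `](a - c)%R, (b - c)%R]%classic); last first.
  by apply/seteqP; split => x /=; rewrite !in_itv/= ltrBlDr lerBrDr.
rewrite !lebesgue_measure_itv/= !lte_fin ltrD2r.
by case: ifP => // _; rewrite -!EFinD; congr EFin; lra.
Qed.

Lemma intRn_shift (n : nat) (f : 'rV[R]_n -> \bar R) (c : 'rV[R]_n) :
  measurable_fun setT (f : BorelRd R n -> _) ->
  (forall x, 0 <= f x) ->
  intRn (fun x => f (x + c)%R) = intRn f.
Proof.
elim: n f c => [|n IH] f c mf f0 /=; first by rewrite (thinmx0 c) addr0.
transitivity (\int[lebesgue_measure]_a intRn (fun y : 'rV[R]_n =>
    f (row_mx (const_mx (a + c 0 0)%R : 'rV[R]_1) y))).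
  apply: eq_integral => a _.
  rewrite -[RHS](IH _ (rsubmx (c : 'rV[R]_(1 + n))))//; last exact: measurable_slice.
  apply: eq_intRn => y; congr f.
  apply/rowP => i; rewrite [LHS]mxE -(splitK (i : 'I_(1 + n))).
  case: (fintype.split _) => k /=.
    rewrite (row_mxEl (const_mx a : 'rV[R]_1)).
    rewrite (row_mxEl (const_mx (a + c 0 0)%R : 'rV[R]_1)) !mxE.
    by congr (_ + c _ _)%R; apply/val_inj; rewrite /= (ord1 k).
  rewrite (row_mxEr (const_mx a : 'rV[R]_1)).
  by rewrite (row_mxEr (const_mx (a + c 0 0)%R : 'rV[R]_1)) !mxE.
apply: (lebesgue_integral_shift (f := fun a => intRn (fun y : 'rV[R]_n =>
    f (row_mx (const_mx a : 'rV[R]_1) y)))).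
  exact: measurable_intRn_slice.
by move=> a; exact: intRn_ge0.
Qed.

(** A set of positive measure does not fit in a null set. This is how almost-everywhere statements
    yield actual jump times and starting points. *)
Lemma ae_exists d (T : measurableType d) (m : {measure set T -> \bar R})
    (A D : set T) (P : T -> Prop) :
  measurable A -> 0 < m A -> A `<=` D -> {ae m, forall x, D x -> P x} ->
  exists2 x, A x & P x.
Proof.
move=> mA mA0 AD [N [mN N0 PN]]; apply: contrapT => h.
suff : m A <= m N by rewrite N0 leNgt mA0.
apply: le_measure; [exact/mem_set|exact/mem_set|] => x Ax; apply: PN => /= Px.
by apply: h; exists x => //; exact/Px/AD.
Qed.

Lemma ge0_integral_eq0_ae d (T : measurableType d) (m : {measure set T -> \bar R})
    (D : set T) (f : T -> \bar R) :
  measurable D -> measurable_fun D f -> (forall x, D x -> 0 <= f x) ->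
  \int[m]_(x in D) f x = 0 -> {ae m, forall x, D x -> f x = 0}.
Proof.
move=> mD mf f0 h; apply: (ae_eq_integral_abs m mD mf).1.
by rewrite -[RHS]h; apply: eq_integral => x /set_mem Dx; rewrite gee0_abs// f0.
Qed.

(** If the outer integral vanished, its positive integrand would vanish somewhere on [0, 1], a set
    of measure one. It makes the normalising constant positive. *)
Lemma intRn_gt0 (n : nat) (f : 'rV[R]_n -> \bar R) :
  measurable_fun setT (f : BorelRd R n -> _) ->
  (forall x, 0 < f x) -> 0 < intRn f.
Proof.
elim: n f => [|n IH] f mf fp /=; first exact: fp.
have f0 x : 0 <= f x by exact: ltW.
have g0 (a : R) : 0 < intRn (fun y : 'rV[R]_n => f (row_mx (const_mx a : 'rV[R]_1) y)).
  by apply: IH => //; exact: measurable_slice.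
rewrite lt_neqAle integral_ge0 ?andbT; last by move=> a _; exact/ltW.
apply/eqP => /esym h.
have := ge0_integral_eq0_ae measurableT (measurable_intRn_slice mf f0)
  (fun a _ => ltW (g0 a)) h.
move=> /(ae_exists (A := `[0%R, 1%R]%classic : set (measurableTypeR R))) [//|||a _] //.
  by rewrite /= lebesgue_measure_itv/= lte_fin ltr01 oppr0 adde0 lte_fin.
by apply/eqP; rewrite gt_eqF.
Qed.
End intRn_theory.

(** * Norms, hazard rates and the flow *)

Section rV_norm.
Context {R : realType} {n : nat}.
Implicit Types x y : 'rV[R]_n.

Lemma coord_le_norm x i : `|x 0 i| <= `|x|.
Proof.
by rewrite [leRHS]/Num.norm /= mx_normrE; apply/bigmax_geP; right; exists (0, i).
Qed.

Lemma norm_le_coord x (r : R) : 0 <= r -> (forall i, `|x 0 i| <= r) -> `|x| <= r.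
Proof.
move=> r0 xr; rewrite [leLHS]/Num.norm /= mx_normrE; apply/bigmax_leP; split => //.
by move=> [j i] _ /=; rewrite (ord1 j).
Qed.

(** The norm is the sup norm, so a closed ball lies in a product of segments, which is compact. *)
Lemma continuous_ball_bounded (g : 'rV[R]_n -> R) x (r : R) : continuous g ->
  exists2 C, 0 < C & forall y, `|y - x| <= r -> `|g y| <= C.
Proof.
move=> cg.
have cK : compact [set v : 'rV[R]_n | forall i, `[x 0 i - r, x 0 i + r]%classic (v 0 i)].
  apply: (@rV_compact _ _ (fun i => `[x 0 i - r, x 0 i + r]%classic)) => i.
  exact: segment_compact.
have /compact_bounded[M [Mr gM]] := continuous_compact (continuous_subspaceT cg) cK.
exists (`|M| + 1); first by rewrite ltr_wpDl.
move=> y yx; apply: gM; first by rewrite (le_lt_trans (ler_norm _))// ltrDl.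
exists y => // i /=; have := le_trans (coord_le_norm (y - x) i) yx.
by rewrite !mxE ler_norml in_itv/= => /andP[h1 h2]; apply/andP; split; lra.
Qed.

End rV_norm.

(** * Antiderivatives and hazard integrals on the line *)

Section calculus.
Context {R : realType}.
Notation mu := (@lebesgue_measure R).

Lemma FTC_segment (f F : R -> R) (b c : R) : b <= c ->
  (forall s, b <= s <= c -> {for s, continuous f}) ->
  (forall s, b <= s <= c -> is_derive s 1 F (f s)) ->
  (\int[mu]_(s in `[b, c]) (f s)%:E = (F c - F b)%:E)%E.
Proof.
rewrite le_eqVlt => /predU1P[<- _ _|bc cf dF].
  by rewrite set_itv1 integral_set1 subrr.
have cF s : b <= s <= c -> {for s, continuous F}.
  by move=> /dF[dFs _]; apply: differentiable_continuous; exact/derivable1_diffP.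
have bb : b <= b <= c by rewrite lexx ltW.
have cc : b <= c <= c by rewrite lexx ltW.
rewrite EFinB; apply: continuous_FTC2 => //.
- by apply: continuous_in_subspaceT => s /set_mem/=; rewrite in_itv/=; exact: cf.
- split.
  + by move=> s; rewrite in_itv/= => /andP[bs sc]; have [] := dF s; rewrite ?(ltW bs) ?(ltW sc).
  + exact/cvg_at_right_filter/cF.
  + exact/cvg_at_left_filter/cF.
- move=> s; rewrite in_itv/= => /andP[bs sc]; rewrite derive1E.
  by have [] := dF s; rewrite ?(ltW bs) ?(ltW sc).
Qed.

Lemma continuous_segment_integrable (a : R -> R) (b c : R) : continuous a ->
  mu.-integrable `[b, c] (EFin \o a).
Proof.
move=> ca; apply: continuous_compact_integrable; first exact: segment_compact.
exact: continuous_subspaceT.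
Qed.

Lemma antiderivative_exists (a : R -> R) : continuous a ->
  exists2 B : R -> R, (forall s : R, 0 <= s -> is_derive s (1 : R) B (a s)) &
    forall b c : R, 0 <= b <= c -> (\int[mu]_(r in `[b, c]) (a r)%:E = (B c - B b)%:E)%E.
Proof.
(* Starting the integral at -1 makes 0 an interior point, where [B] then has a two-sided
   derivative. *)
move=> ca; pose B (s : R) : R := \int[mu]_(r in `[-1, s]) a r.
have dB (s : R) : 0 <= s -> is_derive s (1 : R) B (a s).
  move=> s0; have s1 : -1 < s by exact: lt_le_trans s0.
  have [||] := @continuous_FTC1_closed R a (-1) s (s + 1) _ _ s1 (ca s).
  - by rewrite ltrDl.
  - exact: continuous_segment_integrable.
  by move=> dp pE; split; [exact: dp | rewrite -derive1E].
exists B => // b c /andP[b0 bc]; apply: FTC_segment => // s /andP[bs _].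
  exact: ca.
by apply: dB; exact: le_trans bs.
Qed.

(** The integrand is the derivative of - exp(- B). The value is the probability that a clock with
    cumulative hazard [B] rings before [t]. *)
Lemma integral_hazard (a B : R -> R) (t : R) : continuous a -> 0 <= t ->
  (forall s : R, 0 <= s -> is_derive s (1 : R) B (a s)) -> B 0 = 0 ->
  (\int[mu]_(s in `[0%R, t]) (a s * expR (- B s))%:E = (1 - expR (- B t))%:E)%E.
Proof.
move=> ca t0 dB B0.
have -> : 1 - expR (- B t) = (- expR (- B t)) - (- expR (- B 0)).
  by rewrite B0 oppr0 expR0 opprK addrC.
apply: (FTC_segment (F := fun s => - expR (- B s))) => // s /andP[s0 _].
  apply: continuousM; first exact: ca.
  apply: (continuous_comp (f := fun s => - B s)); last exact: continuous_expR.
  apply: continuousN; apply: differentiable_continuous; apply/derivable1_diffP.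
  by have [] := dB s s0.
have dN : is_derive s (1 : R) (\- B) (- a s) := is_deriveN (dB s s0).
have := is_deriveN (@is_derive1_comp R expR (\- B) s _ _ (is_derive_expR (- B s)) dN).
by rewrite mulrN opprK mulrC.
Qed.

Lemma measurable_integral_itv0 d (T : measurableType d) (tau : T -> R)
    (F : T -> R -> \bar R) :
  measurable_fun setT tau ->
  measurable_fun setT (fun z : T * measurableTypeR R => F z.1 z.2) ->
  (forall t r, 0 <= F t r)%E ->
  measurable_fun setT (fun t => \int[mu]_(r in `[0%R, tau t]) F t r)%E.
Proof.
move=> mtau mF F0.
under eq_fun do rewrite integral_mkcond.
pose G (z : T * measurableTypeR R) : \bar R := if (0 <= z.2) && (z.2 <= tau z.1) then F z.1 z.2 else 0%E.
rewrite (_ : (fun t => _) = (fun t => \int[mu]_r G (t, r))%E); last first.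
  apply/funext => t; apply: eq_integral => r _; rewrite /G patchE mem_setE in_itv//=.
apply: (measurable_fun_fubini_tonelli_F (m2 := mu) G); last first.
  by move=> z; rewrite /G; case: ifP.
apply: measurable_fun_ifT => //.
apply: measurable_and; apply: measurable_fun_ler => //.
exact: measurableT_comp.
Qed.

End calculus.

(** * Velocities and the linear flow *)

Section flow.
Context {R : realType} {d : nat}.
Implicit Types (x : 'rV[R]_d) (v w : vel d).

Lemma voppK : involutive (@vopp d).
Proof. by case=> i b; rewrite /vopp /= negbK. Qed.

Lemma vsign_opp v : vsign R (vopp v) = - vsign R v.
Proof. by rewrite /vsign /=; case: v.2; rewrite /= ?opprK. Qed.

Lemma vsign_norm v : `|vsign R v| = 1.
Proof. by rewrite /vsign; case: v.2; rewrite ?normrN normr1. Qed.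

Lemma vvec_norm v : `|vvec R v| <= 1.
Proof.
apply: norm_le_coord => // i; rewrite !mxE normrM vsign_norm mul1r.
by case: (_ && _); rewrite ?normr1 ?normr0.
Qed.

Lemma continuous_flow x v : continuous (fun s : R => x + s *: vvec R v).
Proof.
move=> s; apply: cvgD; first exact: cvg_cst.
by apply: cvgZl; exact: cvg_id.
Qed.

Lemma measurable_flow v d' (T : measurableType d') (p : T -> BorelRd R d) (s : T -> R) :
  measurable_fun setT p -> measurable_fun setT s ->
  measurable_fun setT (fun t => (p t : 'rV[R]_d) + s t *: vvec R v : BorelRd R d).
Proof.
move=> mp ms; apply: measurable_fun_rV => i.
rewrite (_ : (fun t => _) = (fun t => (p t : 'rV[R]_d) 0 i + s t * vvec R v 0 i)); last first.
  by apply/funext => t; rewrite !mxE.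
apply: measurable_funD; first exact: (measurableT_comp (measurable_coord i)).
exact: measurable_funM.
Qed.

Lemma flow_norm x x0 v (s : R) : 0 <= s -> `|x + s *: vvec R v - x0| <= `|x - x0| + s.
Proof.
move=> s0; rewrite addrAC (le_trans (ler_normD _ _))// lerD2l normrZ ger0_norm//.
by rewrite ler_piMr// vvec_norm.
Qed.

Lemma flowD x v (s r : R) : x + s *: vvec R v + r *: vvec R v = x + (s + r) *: vvec R v.
Proof. by rewrite scalerDl addrA. Qed.

End flow.

(** * The potential along coordinate lines, and its continuity *)

Section potential.
Context {R : realType} {d : nat} (U : 'rV[R]_d -> R) (hU1 : C1 U).
Implicit Types (x : 'rV[R]_d) (v w : vel d).

Lemma is_derive_coord x i (k : R) :
  is_derive k 1 (fun k : R => U (x + k *: ebasis R i)) (partialU U i (x + k *: ebasis R i)).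
Proof.
have dU := hU1.1 i (x + k *: ebasis R i).
have E : (fun h : R => h^-1 *: (((fun k : R => U (x + k *: ebasis R i)) \o shift k) (h *: (1 : R)) - U (x + k *: ebasis R i)))
  = (fun h : R => h^-1 *: ((U \o shift (x + k *: ebasis R i)) (h *: ebasis R i) - U (x + k *: ebasis R i))).
  apply/funext => h /=; rewrite [h *: 1]mulr1 scalerDl; congr (_ *: (U _ - _)).
  by rewrite addrCA addrA.
by split; rewrite /derivable /derive E.
Qed.

Lemma is_derive_flow x v (s : R) :
  is_derive s 1 (fun s : R => U (x + s *: vvec R v))
    (vsign R v * partialU U v.1 (x + s *: vvec R v)).
Proof.
pose g (k : R) := U (x + k *: ebasis R v.1).
have -> : (fun s : R => U (x + s *: vvec R v)) = g \o (fun s => s * vsign R v).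
  by apply/funext => r /=; rewrite /g -scalerA.
have dg := is_derive_coord x v.1 (s * vsign R v).
have dm : is_derive s 1 (fun s : R => s * vsign R v) (vsign R v).
  by apply: is_derive_eq; rewrite /GRing.scale /= mulr0 add0r mulr1.
have := @is_derive1_comp R g (fun s => s * vsign R v) s _ _ dg dm.
by rewrite /= -scalerA mulrC.
Qed.

Lemma coord_lipschitz x i (h C : R) :
  (forall k, `|k| <= `|h| -> `|partialU U i (x + k *: ebasis R i)| <= C) ->
  `|U (x + h *: ebasis R i) - U x| <= C * `|h|.
Proof.
move=> UC; pose g (k : R) := U (x + k *: ebasis R i).
have dg (k : R) : is_derive k (1 : R) g (partialU U i (x + k *: ebasis R i)) by exact: is_derive_coord.
have cg : continuous g.
  by move=> k; apply: differentiable_continuous; apply/derivable1_diffP; have [] := dg k.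
have -> : U x = g 0 by rewrite /g scale0r addr0.
rewrite -/(g h); have [h0|h0] := leP 0 h.
  have [c ch ->] := MVT_segment h0 (fun k _ => dg k) (continuous_subspaceT cg).
  rewrite subr0 normrM ler_wpM2r// UC//.
  by move: ch; rewrite in_itv/= => /andP[c0 ch]; rewrite !ger0_norm.
have [c ch E] := MVT_segment (ltW h0) (fun k _ => dg k) (continuous_subspaceT cg).
rewrite distrC E sub0r normrM normrN ler_wpM2r// UC//.
by move: ch; rewrite in_itv/= => /andP[hc c0]; rewrite !ler0_norm// ?lerN2// ltW.
Qed.

(** [C1] speaks of partial derivatives only. These are bounded near [x], so [U] is Lipschitz along
    each coordinate direction there, and a path from [x] to [y] that changes one coordinate at a
    time bounds [U y - U x]. *)
Lemma continuous_potential : continuous U.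
Proof.
move=> x.
have /choice[C CP] : forall i, exists C : R, 0 < C /\
    forall y : 'rV[R]_d, `|y - x| <= 1 -> `|partialU U i y| <= C.
  move=> i; have [C C0 CP] := continuous_ball_bounded x 1 (hU1.2 i).
  by exists C.
pose K := \sum_i C i.
have CK i : C i <= K.
  by rewrite /K (bigD1 i)//= lerDl sumr_ge0// => j _; have [/ltW] := CP j.
(* The corners of that path: [z y 0] is [x], [z y d] is [y], and all of them stay as close to [x] as
   [y] is. *)
pose z (y : 'rV[R]_d) (k : nat) : 'rV[R]_d := \row_i (if (i < k)%N then y 0 i else x 0 i).
have step (y : 'rV[R]_d) (k : 'I_d) : `|y - x| <= 1 -> `|U (z y k.+1) - U (z y k)| <= K * `|y - x|.
  move=> yx1.
  have zE : z y k.+1 = z y k + (y 0 k - x 0 k) *: ebasis R k.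
    apply/rowP => j; rewrite !mxE /= ltnS leq_eqVlt.
    have [<-|jk] := eqVneq j k; first by rewrite ?eqxx ltnn /= ?mulr1n mulr1 addrC subrK.
    have jk' : (val j == val k) = false by exact/negbTE.
    by rewrite ?jk' ?(negbTE jk) /= mulr0n mulr0 addr0.
  have hk : `|y 0 k - x 0 k| <= `|y - x|.
    by have := coord_le_norm (y - x) k; rewrite !mxE.
  rewrite zE (le_trans (coord_lipschitz (C := K) _))//.
    move=> h hh; rewrite (le_trans _ (CK k))//; apply: (CP k).2.
    apply: norm_le_coord => // j; rewrite !mxE /=.
    have [->|jk] := eqVneq j k.
      by rewrite ltnn ?eqxx /= ?mulr1n mulr1 addrAC subrr add0r (le_trans hh)// (le_trans hk).
    rewrite ?(negbTE jk) /= ?mulr0n mulr0 addr0; case: ifP => _; last by rewrite subrr normr0.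
    by have := coord_le_norm (y - x) j; rewrite !mxE => /le_trans; apply.
  by rewrite ler_wpM2l// /K sumr_ge0// => j _; have [/ltW] := CP j.
have lip (y : 'rV[R]_d) : `|y - x| <= 1 -> `|U y - U x| <= (K *+ d) * `|y - x|.
  move=> yx1.
  have -> : U y - U x = \sum_(k < d) (U (z y k.+1) - U (z y k)).
    rewrite -(big_mkord xpredT (fun k => U (z y k.+1) - U (z y k))) telescope_sumr//.
    by congr (U _ - U _); apply/rowP => j; rewrite mxE ?ltn_ord.
  rewrite (le_trans (ler_norm_sum _ _ _))//.
  rewrite (le_trans (ler_sum _ (fun k _ => step y k yx1)))//.
  by rewrite sumr_const card_ord mulrnAl.
have KD0 : 0 < K *+ d + 1.
  by rewrite ltr_wpDl// mulrn_wge0// sumr_ge0// => j _; have [/ltW] := CP j.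
move=> A /nbhs_ballP[e /= e0 eA]; apply/nbhs_ballP.
exists (Num.min 1 (e / (K *+ d + 1))) => /=; first by rewrite lt_min ltr01 divr_gt0.
move=> y; rewrite -ball_normE /= lt_min distrC => /andP[/ltW yx1 yxe].
apply: eA; rewrite -ball_normE /= distrC (le_lt_trans (lip y yx1))//.
rewrite (@le_lt_trans _ _ ((K *+ d + 1) * `|y - x|))//.
  by rewrite ler_wpM2r// lerDl.
by rewrite mulrC -ltr_pdivlMr.
Qed.

End potential.

(** * Event rates, jump probabilities and survival *)

Section rates.
Context {R : realType} {d : nat} (U : 'rV[R]_d -> R) (hU1 : C1 U).
Context (lref : R) (hlref : 0 < lref).
Implicit Types (x : 'rV[R]_d) (v w : vel d).
Notation mu := (@lebesgue_measure R).
Local Notation ra := (rate U lref).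
Local Notation La := (Lambda U lref).

Lemma continuous_rate v : continuous (fun x => ra x v).
Proof.
move=> x.
apply: (@continuousD _ _ _ (fun x => Num.max (vsign R v * partialU U v.1 x) 0) (fun=> lref)).
  apply: (@continuous_max _ _ (fun x => vsign R v * partialU U v.1 x) (fun=> 0)).
    apply: continuousM; first exact: cst_continuous.
    exact: hU1.2.
  exact: cst_continuous.
exact: cst_continuous.
Qed.

Lemma rate_gt0 x v : 0 < ra x v.
Proof. by rewrite ltr_wpDl// le_max lexx orbT. Qed.

Lemma rate_ge0 x v : 0 <= ra x v.
Proof. exact/ltW/rate_gt0. Qed.

(** The identity a_+ - a = (-a)_+ with a = <v, grad U>. *)
Lemma rate_opp x v : ra x v - vsign R v * partialU U v.1 x = ra x (vopp v).
Proof.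
rewrite /rate vsign_opp mulNr /=.
set g := _ * _; have [g0|g0] := leP g 0.
  by rewrite max_l ?oppr_ge0//; lra.
by rewrite max_r ?oppr_le0 ?(ltW g0)//; lra.
Qed.

(** The velocity [v] serves as a witness that the sum is not empty. *)
Lemma total_rate_gt0 x v : 0 < total_rate U lref x.
Proof.
rewrite /total_rate (bigD1 v)//= ltr_wpDr ?rate_gt0//.
by apply: sumr_ge0 => w _; exact: rate_ge0.
Qed.

Definition jump_prob x w := ra x (vopp w) / total_rate U lref x.

Lemma jump_prob_gt0 x w : 0 < jump_prob x w.
Proof. by rewrite divr_gt0 ?rate_gt0// (total_rate_gt0 _ w). Qed.

Lemma jump_prob_ge0 x w : 0 <= jump_prob x w.
Proof. exact/ltW/jump_prob_gt0. Qed.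

Lemma jump_prob_sum x v : \sum_w jump_prob x w = 1.
Proof.
rewrite -mulr_suml (reindex_inj (inv_inj (@voppK d))) /=.
under eq_bigr do rewrite voppK.
by rewrite divff// gt_eqF// (total_rate_gt0 _ v).
Qed.

Lemma Qop_le (f g : 'rV[R]_d * vel d -> R) x :
  (forall w, f (x, w) <= g (x, w)) -> Qop U lref f x <= Qop U lref g x.
Proof. by move=> fg; apply: ler_sum => w _; rewrite ler_wpM2l// jump_prob_ge0. Qed.

Lemma Qop_ge0 (f : 'rV[R]_d * vel d -> R) x :
  (forall w, 0 <= f (x, w)) -> 0 <= Qop U lref f x.
Proof. by move=> f0; apply: sumr_ge0 => w _; rewrite mulr_ge0// jump_prob_ge0. Qed.

Lemma QopD (f g : 'rV[R]_d * vel d -> R) x :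
  Qop U lref (fun z => f z + g z) x = Qop U lref f x + Qop U lref g x.
Proof. by rewrite /Qop -big_split; apply: eq_bigr => w _; rewrite mulrDr. Qed.

Lemma Qop_cst (c : R) x (v : vel d) : Qop U lref (fun=> c) x = c.
Proof. by rewrite /Qop -mulr_suml (jump_prob_sum x v) mul1r. Qed.

(* Global balance: the total flux into all velocities equals the total flux out
   of them under the reversed rates. *)
Lemma rate_Qop_sum (f : 'rV[R]_d * vel d -> R) x :
  \sum_v ra x v * Qop U lref f x = \sum_v ra x (vopp v) * f (x, v).
Proof.
case: (pickP (@predT (vel d))) => [v0 _|e]; last by rewrite !big_pred0.
rewrite -mulr_suml -/(total_rate U lref x) /Qop mulr_sumr; apply: eq_bigr => w _.
by rewrite mulrA mulrCA divff ?mulr1// gt_eqF// (total_rate_gt0 _ v0).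
Qed.

Lemma continuous_rate_flow x v : continuous (fun s : R => ra (x + s *: vvec R v) v).
Proof.
move=> s; apply: (@continuous_comp _ _ _ (fun s : R => x + s *: vvec R v) (fun y => ra y v)).
  exact: continuous_flow.
exact: continuous_rate.
Qed.

(** [Lambda] vanishes at negative times, hence has a corner at 0. [B] agrees with it at nonnegative
    times and is differentiable at 0 from both sides, so derivatives are taken of [B]. *)
Lemma Lambda_antiderivative x v : exists2 B : R -> R,
  (forall s : R, 0 <= s -> is_derive s (1 : R) B (ra (x + s *: vvec R v) v)) &
  (B 0 = 0 /\ forall s, 0 <= s -> La x v s = B s).
Proof.
have [B dB IB] := antiderivative_exists (continuous_rate_flow (x := x) (v := v)).
exists (fun s => B s - B 0) => [s s0|].
  have := is_deriveB (dB s s0) (is_derive_cst (B 0) s (1 : R)).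
  by rewrite subr0.
split=> [|s s0]; first by rewrite subrr.
by rewrite /Lambda IB// lexx.
Qed.

Lemma Lambda_ge0 x v (s : R) : 0 <= La x v s.
Proof. by rewrite fine_ge0// integral_ge0// => r _; rewrite lee_fin rate_ge0. Qed.

Lemma LambdaD x v (s r : R) : 0 <= s -> 0 <= r ->
  La x v (s + r) = La x v s + La (x + s *: vvec R v) v r.
Proof.
move=> s0 r0; have [B dB [B0 LB]] := Lambda_antiderivative x v.
rewrite !LB ?addr_ge0//; apply/eqP; rewrite addrC -subr_eq; apply/eqP.
rewrite /Lambda.
under eq_integral do rewrite flowD.
have -> : (\int[mu]_(u in `[0%R, r]) (ra (x + (s + u) *: vvec R v) v)%:E =
    (B (s + r) - B (s + 0))%:E)%E; last by rewrite /= addr0 [r + s]addrC; ring.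
apply: (FTC_segment (F := fun u => B (s + u))) => //.
- move=> u _; apply: (@continuous_comp _ _ _ (fun u => s + u) (fun u => ra (x + u *: vvec R v) v)).
    by apply: continuousD; [exact: cst_continuous | exact: cvg_id].
  exact: continuous_rate_flow.
- move=> u /andP[u0 _].
  have ds : is_derive u (1 : R) (fun u => s + u) 1.
    have := is_deriveD (is_derive_cst s u (1 : R)) (is_derive_id u (1 : R)).
    by rewrite add0r.
  have := is_derive1_comp (f := B) (dB _ (addr_ge0 s0 u0)) ds.
  by rewrite mulr1.
Qed.

(** The density of the first jump time integrates to the probability of a jump before [t]. For
    negative [t] the interval is empty and both sides are 0. *)
Lemma integral_survival x v (t : R) :
  (\int[mu]_(s in `[0%R, t]) (ra (x + s *: vvec R v) v * expR (- La x v s))%:E =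
   (1 - expR (- La x v t))%:E)%E.
Proof.
have [t0|t0] := leP 0 t; last first.
  by rewrite /Lambda set_itv_ge -?ltNge// !integral_set0 oppr0 expR0 subrr.
have [B dB [B0 LB]] := Lambda_antiderivative x v.
rewrite LB// -(integral_hazard (continuous_rate_flow (x := x) (v := v)) t0 dB B0).
apply: eq_integral => s /set_mem/=; rewrite in_itv/= => /andP[s0 _].
by rewrite LB.
Qed.

Lemma measurable_rate v : measurable_fun setT (fun x : BorelRd R d => ra x v).
Proof. exact: (measurable_continuous_rV (@continuous_rate v)). Qed.

Lemma continuous_rate_sum (r : seq (vel d)) : continuous (fun x => \sum_(v <- r) ra x v).
Proof.
elim: r => [|v r IH] x.
  rewrite (_ : (fun x => _) = cst 0); first exact: cst_continuous.
  by apply/funext => y; rewrite big_nil.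
rewrite (_ : (fun x => _) = (fun x => ra x v) \+ (fun x => \sum_(v <- r) ra x v)).
  exact: (continuousD (@continuous_rate v x) (IH x)).
by apply/funext => y; rewrite big_cons.
Qed.

Lemma measurable_jump_prob w : measurable_fun setT (fun x : BorelRd R d => jump_prob x w).
Proof.
apply: (measurable_continuous_rV (f := fun x => jump_prob x w)) => x.
apply: (@continuousM _ _ (fun x => ra x (vopp w)) (fun x => (total_rate U lref x)^-1)).
  exact: continuous_rate.
apply: continuousV; first by rewrite gt_eqF// (total_rate_gt0 _ w).
exact: continuous_rate_sum.
Qed.

Lemma measurable_Lambda v d' (T : measurableType d') (p : T -> BorelRd R d) (s : T -> R) :
  measurable_fun setT p -> measurable_fun setT s ->
  measurable_fun setT (fun t => La (p t) v (s t)).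
Proof.
move=> mp ms; apply: measurableT_comp => //.
apply: (measurable_integral_itv0 (F := fun t r => (ra ((p t : 'rV[R]_d) + r *: vvec R v) v)%:E)) => //.
- apply/measurable_EFinP; apply: (measurableT_comp (measurable_rate v)).
  apply: measurable_flow => //; exact: measurableT_comp.
- by move=> t r; rewrite lee_fin rate_ge0.
Qed.

Lemma rate_ball_bounded x (r : R) :
  exists2 C, 0 < C & forall y v, `|y - x| <= r -> ra y v <= C.
Proof.
have /choice[C CP] : forall v, exists C : R, 0 < C /\
    forall y : 'rV[R]_d, `|y - x| <= r -> `|ra y v| <= C.
  by move=> v; have [C C0 CP] := continuous_ball_bounded x r (@continuous_rate v); exists C.
exists (1 + \sum_v C v).
  by rewrite ltr_pwDl// sumr_ge0// => v _; have [/ltW] := CP v.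
move=> y v yx; rewrite (le_trans (ler_norm _))// (le_trans ((CP v).2 _ yx))//.
rewrite (bigD1 v)//= addrCA lerDl addr_ge0// sumr_ge0// => w _.
by have [/ltW] := CP w.
Qed.

Lemma Lambda_le x v (C t : R) : 0 <= t ->
  (forall s, 0 <= s <= t -> ra (x + s *: vvec R v) v <= C) -> La x v t <= C * t.
Proof.
move=> t0 raC; have [B dB [B0 LB]] := Lambda_antiderivative x v.
have cB (s : R) : 0 <= s -> {for s, continuous B}.
  by move=> /dB[? _]; apply: differentiable_continuous; exact/derivable1_diffP.
have [||c + E] := @MVT_segment R B (fun s => ra (x + s *: vvec R v) v) 0 t t0.
- by move=> s; rewrite in_itv/= => /andP[/ltW s0 _]; exact: dB.
- by apply: continuous_in_subspaceT => s /set_mem/=; rewrite in_itv/= => /andP[/cB].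
rewrite in_itv/= => ct; rewrite LB// -[B t]subr0 -B0 E subr0.
by rewrite ler_wpM2r// raC.
Qed.

End rates.

(** * The renewal equation *)

Section lower_integral.
Context d (T : measurableType d) {R : realType} (m : {measure set T -> \bar R}).
Context (D : set T) (mD : measurable D).
Local Open Scope ereal_scope.

(* Monotonicity needs no measurability: for nonnegative functions the library's
   integral is the supremum of the integrals of the simple functions below. *)
Lemma le_lower_integral (f g : T -> \bar R) :
  (forall x, D x -> 0 <= f x) -> (forall x, D x -> f x <= g x) ->
  \int[m]_(x in D) f x <= \int[m]_(x in D) g x.
Proof.
move=> f0 fg; have g0 x : D x -> 0 <= g x by move=> Dx; exact: le_trans (f0 x Dx) (fg x Dx).
rewrite !ge0_integralE//; apply: le_ereal_sup => _ [h hf <-].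
exists h => // x; apply: le_trans (hf x) _.
by rewrite /patch; case: ifPn => [/set_mem/fg|].
Qed.

(** Here [f] may be nonmeasurable, as the integrand of an arbitrary semigroup may be. Additivity of
    the integral is used only for measurable pairs: [f] lies below [g + h], and above a measurable
    function that is within [h] of [g]. *)
Lemma lower_integral_perturb (f g h : T -> R) :
  measurable_fun D g -> measurable_fun D h ->
  (forall x, D x -> 0 <= f x)%R -> (forall x, D x -> 0 <= g x)%R ->
  (forall x, D x -> 0 <= h x)%R -> (forall x, D x -> `|f x - g x| <= h x)%R ->
  \int[m]_(x in D) (f x)%:E <= \int[m]_(x in D) (g x)%:E + \int[m]_(x in D) (h x)%:E /\
  \int[m]_(x in D) (g x)%:E <= \int[m]_(x in D) (f x)%:E + \int[m]_(x in D) (h x)%:E.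
Proof.
move=> mg mh f0 g0 h0 fgh.
have meg : measurable_fun D (EFin \o g) by exact/measurable_EFinP.
have meh : measurable_fun D (EFin \o h) by exact/measurable_EFinP.
split.
  rewrite -ge0_integralD//.
  apply: le_lower_integral => x Dx; rewrite -?EFinD lee_fin ?f0//.
  by have := fgh x Dx; rewrite ler_distlC => /andP[? ?]; lra.
(* A measurable minorant of [f] which stays nonnegative and satisfies [g <= k + h]. *)
pose k x : R := Num.max (g x - h x)%R 0%R.
have mk : measurable_fun D (EFin \o k).
  apply/measurable_EFinP; apply: measurable_maxr => //; exact: measurable_funB.
apply: (@le_trans _ _ (\int[m]_(x in D) (k x)%:E + \int[m]_(x in D) (h x)%:E)).
  rewrite -ge0_integralD//; last by move=> x Dx; rewrite lee_fin le_max lexx orbT.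
  apply: le_lower_integral => x Dx; rewrite -?EFinD lee_fin ?g0//.
  by rewrite -lerBlDr le_max lexx.
rewrite leeD2r//; apply: le_lower_integral => x Dx; rewrite lee_fin.
  by rewrite le_max lexx orbT.
rewrite ge_max f0// andbT.
by have := fgh x Dx; rewrite ler_distlC => /andP[? ?]; lra.
Qed.

End lower_integral.

(** * Existence, uniqueness and locality of solutions *)

Section renewal.
Context {R : realType} {d : nat} (U : 'rV[R]_d -> R) (hU1 : C1 U).
Context (lref : R) (hlref : 0 < lref).
Implicit Types (x : 'rV[R]_d) (v w : vel d) (t s : R).
Implicit Types (f g : 'rV[R]_d * vel d -> R).
Notation mu := (@lebesgue_measure R).
Local Notation ra := (rate U lref).
Local Notation La := (Lambda U lref).
Local Notation Q := (Qop U lref).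

Definition jump_density x v s := ra (x + s *: vvec R v) v * expR (- La x v s).

Definition renewal f (u : R -> 'rV[R]_d * vel d -> R) t x v : \bar R :=
  ((f (x + t *: vvec R v, v) * expR (- La x v t))%:E +
   \int[mu]_(s in `[0%R, t])
     (jump_density x v s * Q (u (t - s)) (x + s *: vvec R v))%:E)%E.

Definition solves f (u : R -> 'rV[R]_d * vel d -> R) :=
  forall t x v, 0 <= t -> (u t (x, v))%:E = renewal f u t x v.

(** Joint measurability in time and position; the iterates and their limit have it, an arbitrary
    semigroup is only known to be measurable in the position. *)
Definition jmeas (u : R -> 'rV[R]_d * vel d -> R) :=
  forall v, measurable_fun setT
    (fun q : measurableTypeR R * BorelRd R d => u q.1 (q.2, v)).

Lemma jump_density_ge0 x v s : 0 <= jump_density x v s.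
Proof. by rewrite mulr_ge0 ?expR_ge0// rate_ge0. Qed.

Lemma measurable_jump_density v d' (T : measurableType d') (p : T -> BorelRd R d)
    (s : T -> R) : measurable_fun setT p -> measurable_fun setT s ->
  measurable_fun setT (fun z => jump_density (p z) v (s z)).
Proof.
move=> mp ms; apply: measurable_funM.
  apply: (measurableT_comp (measurable_rate hU1 lref v)).
  exact: measurable_flow.
apply: measurableT_comp => //; apply: measurableT_comp => //.
exact: measurable_Lambda.
Qed.

Lemma measurable_joint u v d' (T : measurableType d') (s : T -> R) (p : T -> BorelRd R d) :
  jmeas u -> measurable_fun setT s -> measurable_fun setT p ->
  measurable_fun setT (fun z => u (s z) (p z : 'rV[R]_d, v)).
Proof.
move=> mu' ms mp.
apply: (measurableT_comp (mu' v) (g := fun z => (s z, p z) : measurableTypeR R * BorelRd R d)).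
exact: measurable_fun_pair.
Qed.

Lemma measurable_Qop u d' (T : measurableType d') (s : T -> R) (p : T -> BorelRd R d) :
  jmeas u -> measurable_fun setT s -> measurable_fun setT p ->
  measurable_fun setT (fun z => Q (u (s z)) (p z)).
Proof.
move=> mu' ms mp; apply: measurable_sum => w; apply: measurable_funM.
  exact: (measurableT_comp (measurable_jump_prob hU1 hlref w) mp).
exact: measurable_joint.
Qed.

Lemma measurable_renewal_integrand u v d' (T : measurableType d')
    (t s : T -> R) (p : T -> BorelRd R d) :
  jmeas u -> measurable_fun setT t -> measurable_fun setT s -> measurable_fun setT p ->
  measurable_fun setT (fun z =>
    (jump_density (p z) v (s z) * Q (u (t z - s z)) ((p z : 'rV[R]_d) + s z *: vvec R v))%:E).
Proof.
move=> mu' mt ms mp; apply/measurable_EFinP; apply: measurable_funM.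
  exact: measurable_jump_density.
apply: measurable_Qop => //; first exact: measurable_funB.
exact: measurable_flow.
Qed.

Lemma renewal_integrand_ge0 u v t x s : (forall w, 0 <= u (t - s) (x + s *: vvec R v, w)) ->
  0 <= jump_density x v s * Q (u (t - s)) (x + s *: vvec R v).
Proof. by move=> u0; rewrite mulr_ge0 ?jump_density_ge0// Qop_ge0. Qed.

Lemma integral_jump_density x v t (c : R) : 0 <= c ->
  (\int[mu]_(s in `[0%R, t]) (jump_density x v s * c)%:E =
   (c * (1 - expR (- La x v t)))%:E)%E.
Proof.
move=> c0; rewrite EFinM -(integral_survival hU1) -ge0_integralZl_EFin//.
- by apply: eq_integral => s _; rewrite -EFinM mulrC.
- by move=> s _; rewrite lee_fin jump_density_ge0.
- apply/measurable_funTS/measurable_EFinP.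
  exact: (measurable_jump_density v (T := measurableTypeR R) (p := fun=> x) (s := id)).
Qed.

Lemma renewal_ge0 f u t x v : (forall z, 0 <= f z) ->
  (forall s z, 0 <= s -> 0 <= u s z) -> (0 <= renewal f u t x v)%E.
Proof.
move=> f0 u0; apply: adde_ge0; first by rewrite lee_fin mulr_ge0 ?expR_ge0.
apply: integral_ge0 => s /=; rewrite in_itv/= => /andP[s0 st].
by rewrite lee_fin renewal_integrand_ge0// => w; rewrite u0// subr_ge0.
Qed.

Lemma le_renewal f g u u' t x v : (forall z, 0 <= f z <= g z) ->
  (forall s z, 0 <= s -> 0 <= u s z <= u' s z) ->
  (renewal f u t x v <= renewal g u' t x v)%E.
Proof.
move=> fg uu'; apply: leeD.
  by rewrite lee_fin ler_wpM2r ?expR_ge0//; have /andP[] := fg (x + t *: vvec R v, v).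
apply: le_lower_integral => s /=; rewrite in_itv/= => /andP[s0 st]; rewrite lee_fin.
  by apply: renewal_integrand_ge0 => w; have /andP[] := uu' (t - s) (x + s *: vvec R v, w) ltac:(by rewrite subr_ge0).
apply: ler_wpM2l; first exact: jump_density_ge0.
apply: Qop_le => // w; have /andP[] := uu' (t - s) (x + s *: vvec R v, w) ltac:(by rewrite subr_ge0).
by [].
Qed.

(** The probabilities of no jump and of a first jump before [t] add up to one. Constants thus solve
    the equation; they bound the iterates from above and express conservation of mass. *)
Lemma renewal_cst (M : R) t x v : 0 <= M ->
  renewal (fun=> M) (fun _ _ => M) t x v = M%:E.
Proof.
move=> M0; rewrite /renewal.
under eq_integral do rewrite (Qop_cst _ hlref _ _ v).
by rewrite integral_jump_density// -EFinD; congr EFin; ring.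
Qed.

(** Uniqueness and finite speed of propagation at once. In the ball of radius [T] all rates are at
    most [C], so a jump occurs within time [T] with probability at most q = 1 - exp(- C T) < 1, and
    each use of the renewal equation shrinks the bound on [u1 - u2] by the factor [q]. Only [u2] is
    asked to be jointly measurable, so that [u1] can come from an arbitrary semigroup. *)
Lemma light_cone f1 f2 u1 u2 (M T : R) x0 :
  solves f1 u1 -> solves f2 u2 -> jmeas u2 ->
  (forall t z, 0 <= t -> 0 <= u1 t z <= M) ->
  (forall t z, 0 <= t -> 0 <= u2 t z <= M) ->
  (forall y v, `|y - x0| <= T -> f1 (y, v) = f2 (y, v)) ->
  forall t x v, 0 <= t -> `|x - x0| + t <= T -> u1 t (x, v) = u2 t (x, v).
Proof.
move=> s1 s2 mu2 b1 b2 f12.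
have [C C0 CP] := rate_ball_bounded hU1 lref x0 T.
pose q := 1 - expR (- (C * T)).
suff H n t x v : 0 <= t -> `|x - x0| + t <= T -> `|u1 t (x, v) - u2 t (x, v)| <= M * q ^+ n.
  move=> t x v t0 xT; apply/eqP; rewrite -subr_eq0 -normr_le0.
  have T0 : 0 <= T by rewrite (le_trans _ xT)// addr_ge0.
  have q0 : 0 <= q by rewrite subr_ge0 -expR0 ler_expR oppr_le0 mulr_ge0// ltW.
  have q1 : q < 1 by rewrite ltrBlDr ltrDl expR_gt0.
  have cq : M * q ^+ n @[n --> \oo] --> M * 0.
    by apply: cvgMl_tmp; apply: cvg_expr; rewrite ger0_norm.
  rewrite mulr0 in cq; apply: (ler_cvg_to (cvg_cst _) cq).
  by apply: nearW => n; exact: H.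
elim: n t x v => [|n IH] t x v t0 xT.
  rewrite expr0 mulr1; have /andP[? ?] := b1 t (x, v) t0.
  by have /andP[? ?] := b2 t (x, v) t0; rewrite ler_norml; apply/andP; split; lra.
have T0 : 0 <= T by rewrite (le_trans _ xT)// addr_ge0.
have tT : t <= T by rewrite (le_trans _ xT)// lerDr.
have M0 : 0 <= M by have /andP[h1 h2] := b2 0 (x, v) (lexx 0); exact: le_trans h1 h2.
have q0 : 0 <= q by rewrite subr_ge0 -expR0 ler_expR oppr_le0 mulr_ge0// ltW.
have Mq0 : 0 <= M * q ^+ n by rewrite mulr_ge0// exprn_ge0.
have E1 := s1 t x v t0; have E2 := s2 t x v t0; rewrite /renewal in E1 E2.
rewrite (f12 (x + t *: vvec R v) v) in E1; last first.
  by rewrite (le_trans (flow_norm _ _ _ t0)).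
pose g (u : R -> 'rV[R]_d * vel d -> R) s := jump_density x v s * Q (u (t - s)) (x + s *: vvec R v).
pose h s := jump_density x v s * (M * q ^+ n).
have h0 s : 0 <= h s by rewrite mulr_ge0 ?jump_density_ge0.
have mg2 : measurable_fun `[0%R, t]%classic (g u2).
  apply/measurable_EFinP/measurable_funTS.
  exact: (measurable_renewal_integrand v (T := measurableTypeR R) (t := fun=> t) (s := id) (p := fun=> x)).
have mh : measurable_fun `[0%R, t]%classic h.
  apply: measurable_funTS; apply: measurable_funM => //.
  exact: (measurable_jump_density v (T := measurableTypeR R) (p := fun=> x) (s := id)).
have ge1 s : `[0%R, t]%classic s -> 0 <= g u1 s.
  rewrite /= in_itv/= => /andP[s0 st]; apply: renewal_integrand_ge0 => w.
  by have /andP[] := b1 (t - s) (x + s *: vvec R v, w) ltac:(by rewrite subr_ge0).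
have ge2 s : `[0%R, t]%classic s -> 0 <= g u2 s.
  rewrite /= in_itv/= => /andP[s0 st]; apply: renewal_integrand_ge0 => w.
  by have /andP[] := b2 (t - s) (x + s *: vvec R v, w) ltac:(by rewrite subr_ge0).
have gh s : `[0%R, t]%classic s -> `|g u1 s - g u2 s| <= h s.
  rewrite /= in_itv/= => /andP[s0 st].
  rewrite /g /h -mulrBr normrM ger0_norm ?jump_density_ge0// ler_wpM2l ?jump_density_ge0//.
  (* [Q] averages with probabilities, so it preserves the inductive bound, and the moved point stays
     in the cone: |x + s v - x0| + (t - s) <= |x - x0| + t. *)
  rewrite /Qop -sumrB (le_trans (ler_norm_sum _ _ _))//.
  rewrite -[leRHS](Qop_cst U hlref _ (x + s *: vvec R v) v); apply: ler_sum => w _.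
  rewrite -mulrBr normrM (ger0_norm (jump_prob_ge0 U hlref _ _)).
  rewrite ler_wpM2l ?jump_prob_ge0// IH ?subr_ge0//.
  rewrite (le_trans (lerD (flow_norm _ _ _ s0) (lexx _)))//.
  by rewrite -addrA [s + _]addrC subrK.
have [] := lower_integral_perturb mu (measurable_itv _) mg2 mh ge1 ge2 (fun s _ => h0 s) gh.
rewrite (integral_jump_density x v t Mq0).
have Iq : 1 - expR (- La x v t) <= q.
  rewrite lerD2l lerN2 ler_expR lerN2 (@le_trans _ _ (C * t))//.
    apply: Lambda_le => // s /andP[s0 st]; apply: CP.
    rewrite (le_trans (flow_norm _ _ _ s0))// (le_trans _ xT)//.
    by rewrite lerD2l.
  by rewrite ler_wpM2l// ltW.
(* The equation itself makes the integral finite, being a summand of a real number; this permits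
   subtracting. *)
have fin u f : solves f u -> (\int[mu]_(s in `[0%R, t]) (g u s)%:E)%E \is a fin_num.
  move=> /(_ t x v t0)/(congr1 (fun z : \bar R => z \is a fin_num)).
  by rewrite /renewal fin_numD/= => /esym.
have {}E1 : (u1 t (x, v))%:E = ((f2 (x + t *: vvec R v, v) * expR (- La x v t))%:E +
    \int[mu]_(s in `[0%R, t]) (g u1 s)%:E)%E := E1.
have {}E2 : (u2 t (x, v))%:E = ((f2 (x + t *: vvec R v, v) * expR (- La x v t))%:E +
    \int[mu]_(s in `[0%R, t]) (g u2 s)%:E)%E := E2.
move: (fin _ _ s1) (fin _ _ s2) E1 E2.
move: (\int[mu]_(s in `[0%R, t]) (g u1 s)%:E)%E => [r1| |]// _.
move: (\int[mu]_(s in `[0%R, t]) (g u2 s)%:E)%E => [r2| |]// _.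
rewrite -!EFinD => -[->] -[->]; rewrite !lee_fin => h1 h2.
have h3 : M * q ^+ n * (1 - expR (- La x v t)) <= M * q ^+ n.+1.
  by rewrite exprSr mulrA ler_wpM2l.
by rewrite opprD addrACA subrr add0r ler_norml; apply/andP; split; lra.
Qed.

Lemma measurable_renewal f u v :
  (forall w, measurable_fun setT (fun x : BorelRd R d => f (x, w))) ->
  jmeas u -> (forall s z, 0 <= u s z) ->
  measurable_fun setT (fun q : measurableTypeR R * BorelRd R d => renewal f u q.1 q.2 v).
Proof.
move=> mf mu' u0; apply: emeasurable_funD.
  apply/measurable_EFinP; apply: measurable_funM.
    apply: (measurableT_comp (mf v)); exact: measurable_flow.
  apply: measurableT_comp => //; apply: measurableT_comp => //.
  exact: measurable_Lambda.
apply: (measurable_integral_itv0 (T := (measurableTypeR R * BorelRd R d)%type)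
  (F := fun q s => (jump_density q.2 v s * Q (u (q.1 - s)) ((q.2 : 'rV[R]_d) + s *: vvec R v))%:E)) => //.
  apply: (measurable_renewal_integrand v (T := (measurableTypeR R * BorelRd R d * measurableTypeR R)%type)
   (t := fun z => z.1.1) (s := snd) (p := fun z => z.1.2)) => //; exact: measurableT_comp.
by move=> q s; rewrite lee_fin renewal_integrand_ge0.
Qed.

(** For [t >= 0], the expectation of [f] at time [t] over the trajectories with fewer than [n]
    jumps. Starting from 0 makes the sequence nondecreasing. *)
Fixpoint iter_renewal f n t z : R :=
  if n is n'.+1 then fine (renewal f (iter_renewal f n') t z.1 z.2) else 0.

Section iteration.
Context (f : 'rV[R]_d * vel d -> R) (M : R) (fM : forall z, 0 <= f z <= M).

Let M0 : vel d -> 0 <= M.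
Proof. by move=> v; have /andP[h1 h2] := fM (0, v); exact: le_trans h1 h2. Qed.

Lemma iter_renewal_bounds n t z : 0 <= iter_renewal f n t z <= M.
Proof.
elim: n t z => [|n IH] t z /=; first by rewrite lexx M0//; case: z.
have h0 : (0 <= renewal f (iter_renewal f n) t z.1 z.2)%E.
  apply: renewal_ge0 => [z'|s z' _]; first by have /andP[] := fM z'.
  by have /andP[] := IH s z'.
have h1 : (renewal f (iter_renewal f n) t z.1 z.2 <= M%:E)%E.
  by rewrite -(renewal_cst t z.1 z.2 (M0 z.2)); apply: le_renewal.
by case: (renewal _ _ _ _ _) h0 h1 => [r| |]//=; rewrite !lee_fin => -> ->.
Qed.

Lemma iter_renewalS n t z :
  (iter_renewal f n.+1 t z)%:E = renewal f (iter_renewal f n) t z.1 z.2.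
Proof.
rewrite /= fineK//.
have h0 : (0 <= renewal f (iter_renewal f n) t z.1 z.2)%E.
  apply: renewal_ge0 => [z'|s z' _]; first by have /andP[] := fM z'.
  by have /andP[] := iter_renewal_bounds n s z'.
have h1 : (renewal f (iter_renewal f n) t z.1 z.2 <= M%:E)%E.
  rewrite -(renewal_cst t z.1 z.2 (M0 z.2)); apply: le_renewal => // s z' _.
  exact: iter_renewal_bounds.
by case: (renewal _ _ _ _ _) h0 h1.
Qed.

Lemma iter_renewal_nd n t z : iter_renewal f n t z <= iter_renewal f n.+1 t z.
Proof.
elim: n t z => [|n IH] t z; first by have /andP[] := iter_renewal_bounds 1 t z.
rewrite -lee_fin !iter_renewalS; apply: le_renewal => [z'|s z' _].
  by rewrite lexx andbT; have /andP[] := fM z'.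
by rewrite IH andbT; have /andP[] := iter_renewal_bounds n s z'.
Qed.

Lemma iter_renewal_jmeas n :
  (forall w, measurable_fun setT (fun x : BorelRd R d => f (x, w))) ->
  jmeas (iter_renewal f n).
Proof.
move=> mf; elim: n => [|n IH] v; first exact: measurable_cst.
apply: measurableT_comp => //; apply: measurable_renewal => // s z.
by have /andP[] := iter_renewal_bounds n s z.
Qed.

End iteration.

Definition cs_semigroup t f z : R := limn (fun n => iter_renewal f n t z).

Section semigroup.
Context (f : 'rV[R]_d * vel d -> R) (M : R) (fM : forall z, 0 <= f z <= M).
Context (mf : forall w, measurable_fun setT (fun x : BorelRd R d => f (x, w))).

Lemma cs_semigroup_cvg t z :
  iter_renewal f n t z @[n --> \oo] --> cs_semigroup t f z.
Proof.
apply: nondecreasing_is_cvgn.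
  by apply/nondecreasing_seqP => n; exact: iter_renewal_nd.
exists M => _ [n _ <-].
by have /andP[] := iter_renewal_bounds fM n t z.
Qed.

Lemma cs_semigroup_bounds t z : 0 <= cs_semigroup t f z <= M.
Proof.
apply/andP; split.
  apply: (ler_cvg_to (cvg_cst _) (@cs_semigroup_cvg t z)); apply: nearW => n.
  by have /andP[] := iter_renewal_bounds fM n t z.
apply: (ler_cvg_to (@cs_semigroup_cvg t z) (cvg_cst _)); apply: nearW => n.
by have /andP[] := iter_renewal_bounds fM n t z.
Qed.

Lemma cs_semigroup_jmeas : jmeas (fun t => cs_semigroup t f).
Proof.
move=> v; apply: (measurable_fun_cvg (h := fun n (q : measurableTypeR R * BorelRd R d) => iter_renewal f n q.1 (q.2, v))).
  by move=> n; exact: iter_renewal_jmeas.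
by move=> q _; exact: cs_semigroup_cvg.
Qed.

Lemma cvg_Qop (u_ : nat -> 'rV[R]_d * vel d -> R) u x :
  (forall w, u_ n (x, w) @[n --> \oo] --> u (x, w)) ->
  Q (u_ n) x @[n --> \oo] --> Q u x.
Proof.
move=> cu; rewrite /Qop; elim: (index_enum _) => [|w r IH].
  rewrite big_nil; under eq_fun do rewrite big_nil; exact: cvg_cst.
rewrite big_cons; under eq_fun do rewrite big_cons.
by apply: cvgD => //; exact: cvgMl_tmp.
Qed.

Lemma cs_semigroup_solves : solves f (fun t => cs_semigroup t f).
Proof.
move=> t x v t0.
have cL : (iter_renewal f n.+1 t (x, v))%:E @[n --> \oo] --> (cs_semigroup t f (x, v))%:E.
  apply: cvg_EFin; first exact: nearW.
  by rewrite (cvg_shiftS (fun n => iter_renewal f n t (x, v))); exact: cs_semigroup_cvg.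
apply: (cvg_unique _ cL) => //.
rewrite (_ : (fun n => _) = (fun n => renewal f (iter_renewal f n) t x v)); last first.
  by apply/funext => n; rewrite (iter_renewalS fM).
apply: cvgeD => //; first exact: cvg_cst.
rewrite [X in _ --> X](_ : _ = (\int[mu]_(s in `[0%R, t])
    limn (fun n => (jump_density x v s * Q (iter_renewal f n (t - s)) (x + s *: vvec R v))%:E))%E).
  apply: cvg_monotone_convergence => //.
  - move=> n; apply: measurable_funTS.
    apply: (measurable_renewal_integrand v (T := measurableTypeR R) (t := fun=> t) (s := id) (p := fun=> x)) => //.
    exact: iter_renewal_jmeas.
  - move=> n s _; rewrite lee_fin renewal_integrand_ge0// => w.
    by have /andP[] := iter_renewal_bounds fM n (t - s) (x + s *: vvec R v, w).
  - move=> s _; apply/nondecreasing_seqP => n; rewrite lee_fin ler_wpM2l ?jump_density_ge0//.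
    by apply: Qop_le => // w; exact: iter_renewal_nd.
apply: eq_integral => s _; apply/esym/cvg_lim => //.
apply: cvg_EFin; first exact: nearW.
apply: cvgMl_tmp; apply: cvg_Qop => w; exact: cs_semigroup_cvg.
Qed.

End semigroup.

Lemma le_iter_renewal f g M n t z : (forall z, 0 <= f z <= g z) -> (forall z, g z <= M) ->
  iter_renewal f n t z <= iter_renewal g n t z.
Proof.
move=> fg gM.
have fM z' : 0 <= f z' <= M.
  by have /andP[-> h] := fg z'; exact: le_trans h (gM z').
have gM' z' : 0 <= g z' <= M.
  by have /andP[h1 h2] := fg z'; rewrite gM (le_trans h1).
elim: n t z => [//|n IH] t z.
rewrite -lee_fin (iter_renewalS fM) (iter_renewalS gM'); apply: le_renewal => // s z' _.
by rewrite IH andbT; have /andP[] := iter_renewal_bounds fM n s z'.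
Qed.

Lemma le_cs_semigroup f g M t z : (forall z, 0 <= f z <= g z) -> (forall z, g z <= M) ->
  cs_semigroup t f z <= cs_semigroup t g z.
Proof.
move=> fg gM.
have fM z' : 0 <= f z' <= M.
  by have /andP[-> h] := fg z'; exact: le_trans h (gM z').
have gM' z' : 0 <= g z' <= M.
  by have /andP[h1 h2] := fg z'; rewrite gM (le_trans h1).
apply: (ler_cvg_to (@cs_semigroup_cvg _ _ fM t z) (@cs_semigroup_cvg _ _ gM' t z)).
by apply: nearW => n; exact: le_iter_renewal fg gM.
Qed.

Lemma CS_semigroup_exists : CS_semigroup U lref cs_semigroup.
Proof.
move=> t f t0 [[M fM] mf]; split; [split|split].
- by exists M => z; exact: cs_semigroup_bounds.
- move=> v; apply: (@measurable_joint (fun t => cs_semigroup t f) v _ (BorelRd R d) (fun=> t) id) => //.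
  exact: cs_semigroup_jmeas.
- move=> M' fM' z; have fM0 z' : 0 <= f z' <= M' by rewrite fM' andbT; have /andP[] := fM z'.
  by have /andP[] := cs_semigroup_bounds fM0 t z.
- by move=> x v; exact: (cs_semigroup_solves fM mf).
Qed.

(** The light cone with apex [x] and height [t]. The clause that [P] preserves upper bounds supplies
    one bound for all intermediate times, while [testfun] alone gives a bound that may depend on the
    time. *)
Lemma CS_semigroup_unique P t f z : CS_semigroup U lref P -> 0 <= t -> testfun f ->
  P t f z = cs_semigroup t f z.
Proof.
move=> PCS t0 ft; have [[M fM] mf] := ft.
case: z => x v; apply: (light_cone (f1 := f) (f2 := f) (u1 := fun t => P t f)
  (u2 := fun t => cs_semigroup t f) (M := M) (T := t) (x0 := x)) => //.
- by move=> s y w s0; have [_ [_ ->]] := PCS s f s0 ft.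
- exact: cs_semigroup_solves fM mf.
- exact: cs_semigroup_jmeas fM mf.
- move=> s z s0; have [[[M' PM'] _] [Ple _]] := PCS s f s0 ft.
  have /andP[-> _] := PM' z; rewrite Ple// => z'.
  by have /andP[] := fM z'.
- by move=> s z _; exact: cs_semigroup_bounds.
- by rewrite subrr normr0 add0r.
Qed.

Lemma cs_semigroup_local f g M x0 (T : R) t x v :
  (forall z, 0 <= f z <= M) -> (forall z, 0 <= g z <= M) ->
  (forall w, measurable_fun setT (fun x : BorelRd R d => f (x, w))) ->
  (forall w, measurable_fun setT (fun x : BorelRd R d => g (x, w))) ->
  (forall y v, `|y - x0| <= T -> f (y, v) = g (y, v)) ->
  0 <= t -> `|x - x0| + t <= T -> cs_semigroup t f (x, v) = cs_semigroup t g (x, v).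
Proof.
move=> fM gM mf mg fg t0 xT.
apply: (light_cone (f1 := f) (f2 := g) (u1 := fun t => cs_semigroup t f)
  (u2 := fun t => cs_semigroup t g) (M := M) (T := T) (x0 := x0)) => //.
- exact: cs_semigroup_solves fM mf.
- exact: cs_semigroup_solves gM mg.
- exact: cs_semigroup_jmeas gM mg.
- by move=> s z _; exact: cs_semigroup_bounds.
- by move=> s z _; exact: cs_semigroup_bounds.
Qed.

(** Conservation of mass: the sum solves the renewal equation with data 1, as the constant 1 does,
    and the two are compared in a light cone. The bound 2 serves a sum of two functions bounded by
    1. *)
Lemma cs_semigroup_onem f t z : (forall z, 0 <= f z <= 1) ->
  (forall w, measurable_fun setT (fun x : BorelRd R d => f (x, w))) -> 0 <= t ->
  cs_semigroup t f z + cs_semigroup t (fun z => 1 - f z) z = 1.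
Proof.
move=> f1 mf t0.
have g1 z' : 0 <= 1 - f z' <= 1.
  by have /andP[? ?] := f1 z'; apply/andP; split; lra.
have mg w : measurable_fun setT (fun x : BorelRd R d => 1 - f (x, w)).
  by apply: measurable_funB.
case: z => x v; apply: (light_cone (f1 := fun=> 1) (f2 := fun=> 1)
  (u1 := fun t z => cs_semigroup t f z + cs_semigroup t (fun z => 1 - f z) z)
  (u2 := fun _ _ => 1) (M := 2) (T := t) (x0 := x)) => //.
- move=> s y w s0; rewrite EFinD (cs_semigroup_solves f1 mf)// (cs_semigroup_solves g1 mg)//.
  rewrite /renewal addeACA; congr (_ + _)%E.
    by rewrite -EFinD -mulrDl addrC subrK.
  rewrite -ge0_integralD//.
  + by apply: eq_integral => r _; rewrite -EFinD -mulrDr -QopD.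
  + move=> r _; rewrite lee_fin (renewal_integrand_ge0 (u := fun t => cs_semigroup t f))// => w'.
    by have /andP[] := cs_semigroup_bounds f1 (s - r) (y + r *: vvec R w, w').
  + apply: measurable_funTS.
    apply: (measurable_renewal_integrand (u := fun t => cs_semigroup t f) w (T := measurableTypeR R) (t := fun=> s) (s := id) (p := fun=> y)) => //.
    exact: cs_semigroup_jmeas f1 mf.
  + move=> r _; rewrite lee_fin (renewal_integrand_ge0 (u := fun t => cs_semigroup t (fun z => 1 - f z)))// => w'.
    by have /andP[] := cs_semigroup_bounds g1 (s - r) (y + r *: vvec R w, w').
  + apply: measurable_funTS.
    apply: (measurable_renewal_integrand (u := fun t => cs_semigroup t (fun z => 1 - f z)) w (T := measurableTypeR R) (t := fun=> s) (s := id) (p := fun=> y)) => //.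
    exact: cs_semigroup_jmeas g1 mg.
- by move=> s y w s0; rewrite renewal_cst.
- move=> s z _; have /andP[? ?] := cs_semigroup_bounds f1 s z.
  by have /andP[? ?] := cs_semigroup_bounds g1 s z; apply/andP; split; lra.
- by move=> s z _; apply/andP; split; lra.
- by rewrite subrr normr0 add0r.
Qed.

End renewal.

(** * Invariance *)

Section integral_tools.
Context {R : realType}.
Notation mu := (@lebesgue_measure R).
Local Open Scope ereal_scope.

(** Tonelli on the triangle 0 <= s <= r <= t. *)
Lemma integral_triangle (g b : R -> R) (t : R) :
  measurable_fun setT g -> measurable_fun setT b ->
  (forall s, 0 <= g s)%R -> (forall s, 0 <= b s)%R ->
  \int[mu]_(s in `[0%R, t]) ((g s)%:E * \int[mu]_(r in `[s, t]) (b r)%:E) =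
  \int[mu]_(r in `[0%R, t]) ((b r)%:E * \int[mu]_(s in `[0%R, r]) (g s)%:E).
Proof.
move=> mg mb g0 b0.
pose H (z : measurableTypeR R * measurableTypeR R) : \bar R :=
  if [&& 0%R <= z.1, z.1 <= z.2 & z.2 <= t]%R then (g z.1 * b z.2)%:E else 0.
have mH : measurable_fun setT H.
  apply: measurable_fun_ifT => //.
    apply: measurable_and; first exact: measurable_fun_ler.
    by apply: measurable_and; exact: measurable_fun_ler.
  apply/measurable_EFinP; apply: measurable_funM; exact: measurableT_comp.
have H0 z : 0 <= H z by rewrite /H; case: ifP => // _; rewrite lee_fin mulr_ge0.
have := fubini_tonelli (m1 := mu) (m2 := mu) H mH H0.
rewrite [X in X = _ -> _](_ : _ = \int[mu]_(s in `[0%R, t]) ((g s)%:E * \int[mu]_(r in `[s, t]) (b r)%:E)); last first.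
  rewrite [RHS]integral_mkcond; apply: eq_integral => s _.
  rewrite patchE mem_setE in_itv/=; case: ifPn => [/andP[s0 st]|s0t].
    rewrite -ge0_integralZl_EFin//; last 2 first.
    - by move=> r _; rewrite lee_fin.
    - by apply/measurable_EFinP; exact: measurable_funTS.
    rewrite [RHS]integral_mkcond; apply: eq_integral => r _.
    by rewrite patchE mem_setE in_itv/= /H/= s0/= EFinM.
  apply: integral0_eq => r _; rewrite /H/=; case: ifPn => // /and3P[s0 sr rt].
  by move: s0t; rewrite s0 (le_trans sr).
rewrite [X in _ = X -> _](_ : _ = \int[mu]_(r in `[0%R, t]) ((b r)%:E * \int[mu]_(s in `[0%R, r]) (g s)%:E)) //.
rewrite [RHS]integral_mkcond; apply: eq_integral => r _.
rewrite patchE mem_setE in_itv/=; case: ifPn => [/andP[r0 rt]|r0t].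
  rewrite -ge0_integralZl_EFin//; last 2 first.
  - by move=> s _; rewrite lee_fin.
  - by apply/measurable_EFinP; exact: measurable_funTS.
  rewrite [RHS]integral_mkcond; apply: eq_integral => s _.
  by rewrite patchE mem_setE in_itv/= /H/= rt andbT mulrC EFinM.
apply: integral0_eq => s _; rewrite /H/=; case: ifPn => // /and3P[s0 sr rt].
by move: r0t; rewrite rt (le_trans s0).
Qed.

(* If z' = - b and G' = g then (z G)' = z g - b G; this is its integrated form,
   valid for a merely measurable b. *)
Lemma integral_reweight (b g G z : R -> R) (c t : R) : (0 <= t)%R -> (0 <= c)%R ->
  measurable_fun setT g -> measurable_fun setT b -> measurable_fun setT G ->
  (forall s, 0 <= g s)%R -> (forall s, 0 <= b s)%R -> (0 <= G 0%R)%R ->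
  (forall s, 0 <= s <= t -> 0 <= G s - G 0)%R ->
  (forall s, (0 <= s)%R -> \int[mu]_(r in `[0%R, s]) (g r)%:E = (G s - G 0)%:E) ->
  (forall s, (0 <= s <= t)%R -> (z s)%:E = c%:E + \int[mu]_(r in `[s, t]) (b r)%:E) ->
  (z 0 * G 0)%:E + \int[mu]_(s in `[0%R, t]) (g s * z s)%:E =
  (c * G t)%:E + \int[mu]_(s in `[0%R, t]) (G s * b s)%:E.
Proof.
move=> t0 c0 mg mb mG g0 b0 G0 G0s Ig zE.
have Ib0 s : 0 <= \int[mu]_(r in `[s, t]) (b r)%:E.
  by apply: integral_ge0 => r _; rewrite lee_fin.
(* Insert z = c + (integral of b from s to t) and exchange the integrals; the inner one becomes the
   integral of [g], that is [G s - G 0]. *)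
have -> : \int[mu]_(s in `[0%R, t]) (g s * z s)%:E =
    (c * (G t - G 0))%:E + \int[mu]_(s in `[0%R, t]) ((G s - G 0) * b s)%:E.
  transitivity (\int[mu]_(s in `[0%R, t]) ((c * g s)%:E +
      (g s)%:E * \int[mu]_(r in `[s, t]) (b r)%:E)).
    apply: eq_integral => s /set_mem/=; rewrite in_itv/= => st.
    by rewrite EFinM zE// muleDr// ?ge0_adde_def ?inE ?lee_fin// -EFinM mulrC.
  rewrite ge0_integralD//; last 4 first.
  - by move=> s _; rewrite lee_fin mulr_ge0.
  - by apply/measurable_EFinP; apply: measurable_funTS; exact: measurable_funM.
  - by move=> s _; rewrite mule_ge0// lee_fin.
  - apply: measurable_funTS; apply: emeasurable_funM; first exact/measurable_EFinP.
    under eq_fun do rewrite integral_mkcond.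
    pose H (q : measurableTypeR R * measurableTypeR R) : \bar R :=
      if (q.1 <= q.2)%R && (q.2 <= t)%R then (b q.2)%:E else 0.
    rewrite (_ : (fun s => _) = (fun s => \int[mu]_r H (s, r))); last first.
      by apply/funext => s; apply: eq_integral => r _; rewrite patchE mem_setE in_itv.
    apply: (measurable_fun_fubini_tonelli_F (m2 := mu) H); last first.
      by move=> q; rewrite /H; case: ifP => // _; rewrite lee_fin.
    apply: measurable_fun_ifT => //.
      by apply: measurable_and; exact: measurable_fun_ler.
    by apply/measurable_EFinP; exact: measurableT_comp.
  congr (_ + _).
    under eq_integral do rewrite EFinM.
    rewrite ge0_integralZl_EFin//; first by rewrite Ig.
    - by move=> s _; rewrite lee_fin.
    - by apply/measurable_EFinP; exact: measurable_funTS.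
  rewrite integral_triangle//; apply: eq_integral => s /set_mem/=; rewrite in_itv/= => /andP[s0 st].
  by rewrite Ig// -EFinM mulrC.
(* Splitting off [G 0] on this side produces the same term with [G s - G 0], so the two sides match
   without any subtraction of integrals. *)
have -> : \int[mu]_(s in `[0%R, t]) (G s * b s)%:E =
    \int[mu]_(s in `[0%R, t]) (G 0 * b s)%:E + \int[mu]_(s in `[0%R, t]) ((G s - G 0) * b s)%:E.
  rewrite -ge0_integralD//.
  - by apply: eq_integral => s _; rewrite -EFinD -mulrDl addrC subrK.
  - by move=> s _; rewrite lee_fin mulr_ge0.
  - by apply/measurable_EFinP; apply: measurable_funTS; exact: measurable_funM.
  - by move=> s /=; rewrite in_itv/= => st; rewrite lee_fin mulr_ge0// G0s.
  - apply/measurable_EFinP; apply: measurable_funTS; apply: measurable_funM => //.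
    exact: measurable_funB.
have -> : \int[mu]_(s in `[0%R, t]) (G 0 * b s)%:E =
    (G 0)%:E * \int[mu]_(s in `[0%R, t]) (b s)%:E.
  rewrite -ge0_integralZl_EFin//.
  - by move=> s _; rewrite lee_fin.
  - by apply/measurable_EFinP; exact: measurable_funTS.
rewrite mulrC EFinM zE ?lexx//.
move: (\int[mu]_(s in `[0%R, t]) ((G s - G 0) * b s)%:E) => I2.
move: (\int[mu]_(r in `[0%R, t]) (b r)%:E) (Ib0 0%R) => I I0.
rewrite [LHS]addeA [RHS]addeA; congr (_ + _).
rewrite muleDr// ?ge0_adde_def ?inE ?lee_fin// -addeA [X in _ + X]addeC addeA -EFinM -EFinD.
by congr (_ + _); congr EFin; ring.
Qed.

Lemma integral_itv_shift (f : R -> \bar R) (a b c : R) :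
  measurable_fun setT f -> (forall x, 0 <= f x) ->
  \int[mu]_(x in `[a, b]) f (x + c)%R = \int[mu]_(x in `[(a + c)%R, (b + c)%R]) f x.
Proof.
move=> mf f0; rewrite integral_mkcond [RHS]integral_mkcond.
rewrite -[RHS](lebesgue_integral_shift c).
- by apply: eq_integral => x _; rewrite !patchE !mem_setE !in_itv/= lerD2r lerD2r.
- exact/(measurable_restrictT _ _).1/measurable_funTS.
- by move=> x; rewrite patchE; case: ifP.
Qed.

Lemma intRn_fubini_itv n (t : R) (F : R -> 'rV[R]_n -> \bar R) :
  measurable_fun setT (fun z : measurableTypeR R * BorelRd R n => F z.1 z.2) ->
  (forall s x, 0 <= F s x) ->
  intRn (fun x => \int[mu]_(s in `[0%R, t]) F s x) = \int[mu]_(s in `[0%R, t]) intRn (F s).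
Proof.
move=> mF F0.
pose F' s x := if (0 <= s)%R && (s <= t)%R then F s x else 0.
transitivity (intRn (fun x => \int[mu]_s F' s x)).
  apply: eq_intRn => x; rewrite integral_mkcond; apply: eq_integral => s _.
  by rewrite patchE mem_setE in_itv.
rewrite -(intRn_fubini mu (F := F')).
- rewrite [RHS]integral_mkcond; apply: eq_integral => s _.
  by rewrite patchE mem_setE in_itv/= /F'; case: ifP => _ //; exact: intRn0.
- apply: measurable_fun_ifT => //.
  by apply: measurable_and; apply: measurable_fun_ler.
- by move=> s x; rewrite /F'; case: ifP.
Qed.

End integral_tools.

(** * Flux balance for the weight e^-U *)

Section invariance.
Context {R : realType} {d : nat} (U : 'rV[R]_d -> R) (hU1 : C1 U).
Context (lref : R) (hlref : 0 < lref).
Implicit Types (x y : 'rV[R]_d) (v w : vel d) (t s : R).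
Implicit Types (f g : 'rV[R]_d * vel d -> R).
Notation mu := (@lebesgue_measure R).
Local Notation ra := (rate U lref).
Local Notation La := (Lambda U lref).
Local Notation Q := (Qop U lref).
Local Notation cs := (cs_semigroup U lref).

Local Opaque Lambda rate cs_semigroup.

Lemma measurable_expNU : measurable_fun setT (fun x : BorelRd R d => expR (- U x)).
Proof.
apply: measurableT_comp => //; apply: measurableT_comp => //.
exact: (measurable_continuous_rV (continuous_potential hU1)).
Qed.

Definition weighted_sum (h : 'rV[R]_d * vel d -> R) x : \bar R :=
  (\sum_(v : vel d) (h (x, v) * expR (- U x))%:E)%E.

Lemma intRn_weighted_sum (h : 'rV[R]_d * vel d -> R) : (forall z, 0 <= h z) ->
  (forall w, measurable_fun setT (fun x : BorelRd R d => h (x, w))) ->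
  (intRn (weighted_sum h) = \sum_(v : vel d) intRn (fun x => (h (x, v) * expR (- U x))%:E))%E.
Proof.
move=> h0 mh; apply: (intRn_sum _ (f := fun v x => (h (x, v) * expR (- U x))%:E)) => [v|v x].
  by apply/measurable_EFinP; apply: measurable_funM => //; exact: measurable_expNU.
by rewrite lee_fin mulr_ge0 ?expR_ge0.
Qed.

Section test_function.
Context (f : 'rV[R]_d * vel d -> R) (M : R) (fM : forall z, 0 <= f z <= M).
Context (mf : forall w, measurable_fun setT (fun x : BorelRd R d => f (x, w))).

Let cs_ge0 s z : 0 <= cs s f z.
Proof. by have /andP[] := cs_semigroup_bounds hU1 hlref fM s z. Qed.

Let cs_solves := cs_semigroup_solves hU1 hlref fM mf.
Let cs_jmeas := cs_semigroup_jmeas hU1 hlref fM mf.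

(* The renewal equation seen from the intermediate point at time s. *)
Lemma survival_renewal x v t s : 0 <= s <= t ->
  (cs (t - s) f (x + s *: vvec R v, v) * expR (- La x v s))%:E =
  ((f (x + t *: vvec R v, v) * expR (- La x v t))%:E +
   \int[mu]_(r in `[s, t]) (jump_density U lref x v r * Q (cs (t - r) f) (x + r *: vvec R v))%:E)%E.
Proof.
move=> /andP[s0 st].
have ts0 : 0 <= t - s by rewrite subr_ge0.
rewrite mulrC EFinM (cs_solves _ _ ts0) /renewal muleDr//.
congr (_ + _)%E.
  rewrite -EFinM flowD [s + _]addrC subrK mulrCA -expRD; congr (_ * expR _)%:E.
  have -> : La x v t = La x v s + La (x + s *: vvec R v) v (t - s).
    by rewrite -LambdaD// addrC subrK.
  by rewrite opprD.
rewrite -ge0_integralZl_EFin//; last 2 first.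
- by move=> r _; rewrite lee_fin (renewal_integrand_ge0 U hlref (u := fun t => cs t f)).
- apply: measurable_funTS.
  exact: (measurable_renewal_integrand hU1 hlref (u := fun t => cs t f) v (T := measurableTypeR R)
    (t := fun=> t - s) (s := id) (p := fun=> x + s *: vvec R v)).
pose b r := (jump_density U lref x v r * Q (cs (t - r) f) (x + r *: vvec R v))%:E.
transitivity (\int[mu]_(r in `[0%R, (t - s)%R]) b (r + s)%R)%E.
  apply: eq_integral => r /set_mem/=; rewrite in_itv/= => /andP[r0 _].
  rewrite /b /jump_density -EFinM flowD [s + r]addrC.
  have -> : t - s - r = t - (r + s) by ring.
  have -> : expR (- La x v (r + s)) =
      expR (- La x v s) * expR (- La (x + s *: vvec R v) v r).
    by rewrite [r + s]addrC LambdaD// opprD expRD.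
  have mulE (a1 a2 a3 a4 : R) : a2 * (a1 * a3 * a4) = a1 * (a2 * a3) * a4 by ring.
  by congr EFin; exact: mulE.
rewrite (integral_itv_shift (f := b) 0 (t - s) s) ?add0r ?subrK//.
- exact: (measurable_renewal_integrand hU1 hlref (u := fun t => cs t f) v (T := measurableTypeR R)
    (t := fun=> t) (s := id) (p := fun=> x)).
- by move=> r; rewrite lee_fin (renewal_integrand_ge0 U hlref (u := fun t => cs t f)).
Qed.

(* Integrated along the flow, [e^-U u] is driven by the reversed rates: this is
   where [lambda(x,v) - lambda(x,-v) = <v, grad U>] enters. *)
Lemma reversed_renewal x v t : 0 <= t ->
  ((cs t f (x, v) * expR (- U x))%:E +
   \int[mu]_(s in `[0%R, t]) (expR (- U (x + s *: vvec R v)) *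
      (ra (x + s *: vvec R v) (vopp v) * cs (t - s) f (x + s *: vvec R v, v)))%:E =
   (f (x + t *: vvec R v, v) * expR (- U (x + t *: vvec R v)))%:E +
   \int[mu]_(s in `[0%R, t]) (expR (- U (x + s *: vvec R v)) *
      (ra (x + s *: vvec R v) v * Q (cs (t - s) f) (x + s *: vvec R v)))%:E)%E.
Proof.
move=> t0; have [B dB [B0 LB]] := Lambda_antiderivative hU1 lref x v.
have mflow : measurable_fun setT (fun s : measurableTypeR R => x + s *: vvec R v : BorelRd R d).
  exact: (measurable_flow v (T := measurableTypeR R) (p := fun=> x) (s := id)).
have mLa : measurable_fun setT (fun s : measurableTypeR R => La x v s).
  exact: (measurable_Lambda hU1 hlref v (T := measurableTypeR R) (p := fun=> x) (s := id)).
have mU : measurable_fun setT (fun s : measurableTypeR R => U (x + s *: vvec R v)).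
  exact: (measurableT_comp (measurable_continuous_rV (continuous_potential hU1)) mflow).
(* The integrating factor: Lambda - U has derivative lambda(x,v) - <v, grad U> = lambda(x,-v) along
   the flow, so G' = g, and [G s] times the survival probability is e^-U at the moved point. *)
pose G s := expR (La x v s - U (x + s *: vvec R v)).
pose g s := ra (x + s *: vvec R v) (vopp v) * G s.
pose b s := jump_density U lref x v s * Q (cs (t - s) f) (x + s *: vvec R v).
pose z s := cs (t - s) f (x + s *: vvec R v, v) * expR (- La x v s).
pose c := f (x + t *: vvec R v, v) * expR (- La x v t).
have mG : measurable_fun setT G.
  by apply: measurableT_comp => //; exact: measurable_funB.
have mg : measurable_fun setT g.
  apply: measurable_funM => //.
  exact: (measurableT_comp (measurable_rate hU1 lref (vopp v)) mflow).
have mb : measurable_fun setT b.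
  apply/measurable_EFinP.
  exact: (measurable_renewal_integrand hU1 hlref (u := fun t => cs t f) v (T := measurableTypeR R)
    (t := fun=> t) (s := id) (p := fun=> x)).
have g0 s : 0 <= g s by rewrite mulr_ge0 ?expR_ge0// rate_ge0.
have b0 s : 0 <= b s by apply: (renewal_integrand_ge0 U hlref (u := fun t => cs t f)).
have c0 : 0 <= c.
  by rewrite mulr_ge0 ?expR_ge0//; have /andP[] := fM (x + t *: vvec R v, v).
(* The same function with [B] for [Lambda], differentiable at 0 as well. *)
pose G' s := expR (B s - U (x + s *: vvec R v)).
have dG s : 0 <= s -> is_derive s (1 : R) G' (ra (x + s *: vvec R v) (vopp v) * G' s).
  move=> s0; have dBU := is_deriveB (dB s s0) (is_derive_flow hU1 x v s).
  have := @is_derive1_comp R expR _ s _ _ (is_derive_expR _) dBU.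
  by rewrite rate_opp mulrC.
have cG (s : R) : 0 <= s -> {for s, continuous G'}.
  by move=> /dG[? _]; apply: differentiable_continuous; exact/derivable1_diffP.
have Ig s : 0 <= s -> (\int[mu]_(r in `[0%R, s]) (g r)%:E = (G s - G 0)%:E)%E.
  move=> s0; rewrite /G !LB//.
  transitivity (\int[mu]_(r in `[0%R, s]) (ra (x + r *: vvec R v) (vopp v) * G' r)%:E)%E.
    by apply: eq_integral => r /set_mem/=; rewrite in_itv/= => /andP[r0 _]; rewrite /g /G LB.
  apply: (FTC_segment (F := G')) => // r /andP[r0 _]; last exact: dG.
  apply: continuousM; last exact: cG.
  apply: (@continuous_comp _ _ _ (fun s : R => x + s *: vvec R v) (fun y => ra y (vopp v))).
    exact: continuous_flow.
  exact: continuous_rate.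
have G0s s : 0 <= s <= t -> 0 <= G s - G 0.
  by move=> /andP[s0 _]; rewrite -lee_fin -Ig//; apply: integral_ge0 => r _; rewrite lee_fin.
have zE s : 0 <= s <= t -> (z s)%:E = (c%:E + \int[mu]_(r in `[s, t]) (b r)%:E)%E.
  exact: survival_renewal.
have GE s : expR (- U (x + s *: vvec R v)) = G s * expR (- La x v s).
  by rewrite /G -expRD addrAC subrr add0r.
have := integral_reweight t0 c0 mg mb mG g0 b0 (expR_ge0 _) G0s Ig zE.
rewrite (_ : z 0 * G 0 = cs t f (x, v) * expR (- U x)); last first.
  by rewrite /z subr0 scale0r addr0 mulrAC -mulrA -GE scale0r addr0.
rewrite (_ : c * G t = f (x + t *: vvec R v, v) * expR (- U (x + t *: vvec R v))); last first.
  by rewrite GE /c mulrAC mulrA.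
move=> E; rewrite [X in (_ + X)%E = _](_ : _ = \int[mu]_(s in `[0%R, t]) (g s * z s)%:E)%E.
  rewrite E; congr (_ + _)%E; apply: eq_integral => s _; congr EFin.
  by rewrite GE /b /jump_density; ring.
by apply: eq_integral => s _; congr EFin; rewrite GE /g /z; ring.
Qed.

Lemma measurable_cs_time t v d' (T : measurableType d') (s : T -> R) (p : T -> BorelRd R d) :
  measurable_fun setT s -> measurable_fun setT p ->
  measurable_fun setT (fun q => cs (t - s q) f (p q : 'rV[R]_d, v)).
Proof.
move=> ms mp; apply: (measurable_joint v cs_jmeas (s := fun q => t - s q)) => //.
exact: measurable_funB.
Qed.

(** A support in the ball of radius [r] confines the evolved function to the ball of radius [r + t],
    where the rates are at most [C]. The flux is then at most [C * M] times e^-U, hence integrable,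
    and can be cancelled from both sides. *)
Lemma invariance_bounded_support t (r : R) : 0 <= t -> 0 <= M ->
  (intRn (fun x => (expR (- U x))%:E) < +oo)%E ->
  (forall x v, r < `|x| -> f (x, v) = 0) ->
  (\sum_(v : vel d) intRn (fun x => (cs t f (x, v) * expR (- U x))%:E) =
   \sum_(v : vel d) intRn (fun x => (f (x, v) * expR (- U x))%:E))%E.
Proof.
move=> t0 M0 Zfin f_supp.
(* The two fluxes of [reversed_renewal], seen from the moved point. Their totals over the velocities
   agree, so bounding [J] also bounds [K]. *)
pose J v s y := (expR (- U y) * (ra y (vopp v) * cs (t - s) f (y, v)))%:E.
pose K v s y := (expR (- U y) * (ra y v * Q (cs (t - s) f) y))%:E.
have J0 v s y : (0 <= J v s y)%E by rewrite lee_fin !mulr_ge0 ?expR_ge0 ?rate_ge0.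
have K0 v s y : (0 <= K v s y)%E.
  by rewrite lee_fin !mulr_ge0 ?expR_ge0 ?rate_ge0// Qop_ge0.
have mJ v d' (T : measurableType d') (s : T -> R) (p : T -> BorelRd R d) :
    measurable_fun setT s -> measurable_fun setT p ->
    measurable_fun setT (fun q => J v (s q) (p q)).
  move=> ms mp; apply/measurable_EFinP; apply: measurable_funM.
    exact: (measurableT_comp measurable_expNU mp).
  apply: measurable_funM; last exact: measurable_cs_time.
  exact: (measurableT_comp (measurable_rate hU1 lref (vopp v)) mp).
have mK v d' (T : measurableType d') (s : T -> R) (p : T -> BorelRd R d) :
    measurable_fun setT s -> measurable_fun setT p ->
    measurable_fun setT (fun q => K v (s q) (p q)).
  move=> ms mp; apply/measurable_EFinP; apply: measurable_funM.
    exact: (measurableT_comp measurable_expNU mp).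
  apply: measurable_funM.
    exact: (measurableT_comp (measurable_rate hU1 lref v) mp).
  apply: (measurable_Qop hU1 hlref (u := fun t => cs t f) (s := fun q => t - s q)) => //.
  exact: measurable_funB.
have mpt v (s : R) : measurable_fun setT (fun x : BorelRd R d => (x : 'rV[R]_d) + s *: vvec R v : BorelRd R d).
  exact: (measurable_flow v (T := BorelRd R d) (p := id) (s := fun=> s)).
have mflow v : measurable_fun setT (fun q : measurableTypeR R * BorelRd R d =>
    (q.2 : 'rV[R]_d) + q.1 *: vvec R v : BorelRd R d).
  exact: measurable_flow.
have mF (h : 'rV[R]_d * vel d -> R) v : measurable_fun setT (fun x : BorelRd R d => h (x, v)) ->
    measurable_fun setT (fun x : BorelRd R d => (h (x, v) * expR (- U x))%:E).
  by move=> mh; apply/measurable_EFinP; apply: measurable_funM => //; exact: measurable_expNU.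
have mcs v : measurable_fun setT (fun x : BorelRd R d => cs t f (x, v)).
  exact: (measurable_joint v cs_jmeas (s := fun=> t) (p := id)).
have intS (H : vel d -> R -> 'rV[R]_d -> \bar R) v :
    (forall d' (T : measurableType d') (s : T -> R) (p : T -> BorelRd R d),
      measurable_fun setT s -> measurable_fun setT p ->
      measurable_fun setT (fun q => H v (s q) (p q))) ->
    (forall s y, 0 <= H v s y)%E ->
    intRn (fun x => \int[mu]_(s in `[0%R, t]) H v s (x + s *: vvec R v)%R)%E =
    (\int[mu]_(s in `[0%R, t]) intRn (H v s))%E.
  move=> mH H0; rewrite (intRn_fubini_itv t (F := fun s x => H v s (x + s *: vvec R v))) //.
    apply: eq_integral => s _; apply: (intRn_shift (f := H v s)) => //.
    exact: (mH _ (BorelRd R d) (fun=> s) id).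
  exact: (mH _ (measurableTypeR R * BorelRd R d)%type fst (fun q => (q.2 : 'rV[R]_d) + q.1 *: vvec R v)).
have mint (H : vel d -> R -> 'rV[R]_d -> \bar R) v :
    (forall d' (T : measurableType d') (s : T -> R) (p : T -> BorelRd R d),
      measurable_fun setT s -> measurable_fun setT p ->
      measurable_fun setT (fun q => H v (s q) (p q))) ->
    (forall s y, 0 <= H v s y)%E ->
    measurable_fun setT (fun x : BorelRd R d =>
      \int[mu]_(s in `[0%R, t]) H v s ((x : 'rV[R]_d) + s *: vvec R v)%R)%E.
  move=> mH H0; apply: (measurable_integral_itv0 (T := BorelRd R d) (tau := fun=> t)
    (F := fun x s => H v s ((x : 'rV[R]_d) + s *: vvec R v))) => //.
  apply: (mH _ (BorelRd R d * measurableTypeR R)%type snd (fun q => (q.1 : 'rV[R]_d) + q.2 *: vvec R v)) => //.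
  exact: measurable_flow.
have int0 (H : vel d -> R -> 'rV[R]_d -> \bar R) v x : (forall s y, 0 <= H v s y)%E ->
    (0 <= \int[mu]_(s in `[0%R, t]) H v s (x + s *: vvec R v)%R)%E.
  by move=> H0; apply: integral_ge0.
have Ev v : (intRn (fun x => (cs t f (x, v) * expR (- U x))%:E) +
     \int[mu]_(s in `[0%R, t]) intRn (J v s) =
     intRn (fun x => (f (x, v) * expR (- U x))%:E) +
     \int[mu]_(s in `[0%R, t]) intRn (K v s))%E.
  rewrite -!intS//; try exact: mJ; try exact: mK.
  rewrite -(intRn_shift (f := fun x => (f (x, v) * expR (- U x))%:E) (t *: vvec R v)); last 2 first.
  - exact: mF.
  - by move=> x; rewrite lee_fin mulr_ge0 ?expR_ge0//; have /andP[] := fM (x, v).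
  rewrite -intRnD; last 4 first.
  - exact: mF.
  - by apply: mint => //; exact: mJ.
  - by move=> x; rewrite lee_fin mulr_ge0 ?expR_ge0.
  - by move=> x; exact: int0.
  rewrite -intRnD; last 4 first.
  - exact: (measurableT_comp (mF f v (mf v)) (mpt v t)).
  - by apply: mint => //; exact: mK.
  - by move=> x; rewrite lee_fin mulr_ge0 ?expR_ge0//; have /andP[] := fM (x + t *: vvec R v, v).
  - by move=> x; exact: int0.
  by apply: eq_intRn => x; exact: reversed_renewal.
have mintJ v : measurable_fun `[0%R, t]%classic (fun s : measurableTypeR R => intRn (J v s)).
  apply: measurable_funTS; apply: (measurable_intRn (F := J v)) => //; exact: mJ.
have mintK v : measurable_fun `[0%R, t]%classic (fun s : measurableTypeR R => intRn (K v s)).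
  apply: measurable_funTS; apply: (measurable_intRn (F := K v)) => //; exact: mK.
have JK : (\sum_v \int[mu]_(s in `[0%R, t]) intRn (J v s) =
           \sum_v \int[mu]_(s in `[0%R, t]) intRn (K v s))%E.
  rewrite -!ge0_integral_sum//; last 2 first.
  - by move=> v s _; exact: intRn_ge0.
  - by move=> v s _; exact: intRn_ge0.
  apply: eq_integral => s _; rewrite -!intRn_sum//; last 2 first.
  - by move=> v; exact: (mK v _ (BorelRd R d) (fun=> s) id).
  - by move=> v; exact: (mJ v _ (BorelRd R d) (fun=> s) id).
  apply: eq_intRn => y; rewrite !sumEFin -!mulr_sumr; congr ((_ * _)%:E).
  by rewrite rate_Qop_sum.
have [C C0 CP] := rate_ball_bounded hU1 lref (0 : 'rV[R]_d) (r + t).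
have Jle v s y : 0 <= s <= t -> (J v s y <= (C * M)%:E * (expR (- U y))%:E)%E.
  move=> /andP[s0 st]; rewrite -EFinM lee_fin mulrC ler_wpM2r ?expR_ge0//.
  have [yr|yr] := leP `|y| (r + t).
    have /andP[_ csM] := cs_semigroup_bounds hU1 hlref fM (t - s) (y, v).
    by rewrite ler_pM ?rate_ge0// CP// subr0.
  (* From such a [y], every point reachable in time [t - s] is outside the support, so locality
     replaces [f] by 0. *)
  rewrite (@cs_semigroup_local _ _ _ hU1 _ hlref f (fun=> 0) M y (t - s)) //.
  - have /andP[_ cs00] := cs_semigroup_bounds hU1 hlref (f := fun=> 0) (M := 0) (fun=> ltac:(by rewrite lexx)) (t - s) (y, v).
    by rewrite (le_trans (ler_wpM2l (rate_ge0 _ hlref _ _) cs00))// mulr0 mulr_ge0// ltW.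
  - by move=> _; rewrite lexx.
  - move=> y' w yy'; apply: f_supp.
    have : `|y| <= `|y'| + `|y' - y|.
      by rewrite -[y in `|y|](subKr y' y) (le_trans (ler_normB _ _)).
    by lra.
  - by rewrite subr_ge0.
  - by rewrite subrr normr0 add0r.
have Jfin v : (\int[mu]_(s in `[0%R, t]) intRn (J v s) < +oo)%E.
  apply: (@le_lt_trans _ _ (\int[mu]_(s in `[0%R, t]) ((C * M)%:E * intRn (fun x => (expR (- U x))%:E)))%E).
    apply: ge0_le_integral => //.
    - by move=> s _; exact: intRn_ge0.
    - exact: mintJ.
    - move=> s /=; rewrite in_itv/= => st; rewrite -intRnZl//.
      + apply: le_intRn => //.
        * exact: (mJ v _ (BorelRd R d) (fun=> s) id).
        * apply: measurable_funeM; apply/measurable_EFinP; exact: measurable_expNU.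
        * by move=> y; exact: Jle.
      + by rewrite mulr_ge0// ltW.
      + by apply/measurable_EFinP; exact: measurable_expNU.
  have [k ->] : exists k : R, ((C * M)%:E * intRn (fun x => (expR (- U x))%:E) = k%:E)%E.
    have Z0 : (0 <= intRn (fun x => (expR (- U x))%:E))%E by exact: intRn_ge0.
    by case: (intRn _) Z0 Zfin => [z| |]// _ _; exists (C * M * z).
  rewrite (_ : (\int[mu]_(s in `[0%R, t]) k%:E)%E = (k%:E * mu `[0%R, t]%classic)%E).
    by rewrite lebesgue_measure_itv/=; case: ifP => _; rewrite -?EFinB -?EFinM ?mule0 ltry.
  exact: integral_cst.
have E : (\sum_v intRn (fun x => (cs t f (x, v) * expR (- U x))%:E) +
    \sum_v \int[mu]_(s in `[0%R, t]) intRn (K v s) =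
    \sum_v intRn (fun x => (f (x, v) * expR (- U x))%:E) +
    \sum_v \int[mu]_(s in `[0%R, t]) intRn (K v s))%E.
  by rewrite -[in LHS]JK -!big_split; apply: eq_bigr => v _; exact: Ev.
have Kfin : (\sum_v \int[mu]_(s in `[0%R, t]) intRn (K v s))%E \is a fin_num.
  rewrite -JK ge0_fin_numE; last first.
    by apply: sume_ge0 => v _; apply: integral_ge0 => s _; exact: intRn_ge0.
  by apply: lte_sum_pinfty => v _; exact: Jfin.
by move/(congr1 (fun e => e - \sum_v \int[mu]_(s in `[0%R, t]) intRn (K v s))%E): E; rewrite !addeK.
Qed.

End test_function.

Lemma cvg_weighted_sum (h_ : nat -> 'rV[R]_d * vel d -> R) (h : 'rV[R]_d * vel d -> R) :
  (forall n z, 0 <= h_ n z) ->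
  (forall n w, measurable_fun setT (fun x : BorelRd R d => h_ n (x, w))) ->
  (forall n z, h_ n z <= h_ n.+1 z) ->
  (forall x, exists N, forall n v, (N <= n)%N -> h_ n (x, v) = h (x, v)) ->
  intRn (weighted_sum (h_ n)) @[n --> \oo] --> intRn (weighted_sum h).
Proof.
move=> h0 mh hn hE.
rewrite (_ : weighted_sum h = fun x => limn (fun n => weighted_sum (h_ n) x)).
  apply: cvg_intRn => [n|n x|x].
  - apply: emeasurable_sum => v; apply/measurable_EFinP; apply: measurable_funM => //.
    exact: measurable_expNU.
  - by apply: sume_ge0 => v _; rewrite lee_fin mulr_ge0 ?expR_ge0.
  - apply/nondecreasing_seqP => n; apply: lee_sum => v _.
    by rewrite lee_fin ler_wpM2r ?expR_ge0.
apply/funext => x; apply/esym/cvg_lim => //.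
have [N NE] := hE x; apply: cvg_near_cst; exists N => // n /= Nn.
by apply: eq_bigr => v _; rewrite NE.
Qed.

Lemma cs_invariant f M t : 0 <= t -> (forall z, 0 <= f z <= M) ->
  (forall w, measurable_fun setT (fun x : BorelRd R d => f (x, w))) ->
  (intRn (fun x => (expR (- U x))%:E) < +oo)%E ->
  (\sum_(v : vel d) intRn (fun x => (cs t f (x, v) * expR (- U x))%:E) =
   \sum_(v : vel d) intRn (fun x => (f (x, v) * expR (- U x))%:E))%E.
Proof.
move=> t0 fM mf Zfin.
case: (pickP (@predT (vel d))) => [v0 _|e]; last by rewrite !big_pred0.
have M0 : 0 <= M by have /andP[h1 h2] := fM (0, v0); exact: le_trans h1 h2.
pose f_ (n : nat) (z : 'rV[R]_d * vel d) : R := if `|z.1| <= n%:R then f z else 0.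
have f_M n z : 0 <= f_ n z <= M by rewrite /f_; case: ifP => // _; rewrite lexx.
have mf_ n w : measurable_fun setT (fun x : BorelRd R d => f_ n (x, w)).
  apply: measurable_fun_ifT => //; apply: measurable_fun_ler => //.
  by apply: measurable_continuous_rV; exact: norm_continuous.
have f_nd n z : f_ n z <= f_ n.+1 z.
  rewrite /f_; case: ifP => [h|_]; last by case: ifP => // _; have /andP[] := fM z.
  by rewrite (le_trans h) ?ler_nat.
have f0 z : 0 <= f z by have /andP[] := fM z.
have f_0 n z : 0 <= f_ n z by have /andP[] := f_M n z.
have mcs g : (forall z, 0 <= g z <= M) ->
    (forall w, measurable_fun setT (fun x : BorelRd R d => g (x, w))) ->
    forall v, measurable_fun setT (fun x : BorelRd R d => cs t g (x, v)).
  move=> gM mg v.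
  exact: (measurable_joint v (cs_semigroup_jmeas hU1 hlref gM mg) (s := fun=> t) (p := id)).
have c1 : intRn (weighted_sum (f_ n)) @[n --> \oo] --> intRn (weighted_sum f).
  apply: cvg_weighted_sum => // x; exists (Num.truncn `|x|).+1 => n v xn.
  rewrite /f_ /= ifT// (le_trans (ltW (truncnS_gt _)))// ler_nat//.
have c2 : intRn (weighted_sum (cs t (f_ n))) @[n --> \oo] --> intRn (weighted_sum (cs t f)).
  apply: cvg_weighted_sum => [n z|n w|n z|x].
  - by have /andP[] := cs_semigroup_bounds hU1 hlref (f_M n) t z.
  - exact: mcs.
  - apply: (le_cs_semigroup hU1 hlref (M := M)) => z'; first by rewrite f_0 f_nd.
    by have /andP[] := f_M n.+1 z'.
  (* By locality the evolved truncations at [x] are eventually equal to the evolved [f]: truncating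
     beyond [|x| + t] is not seen within time [t]. *)
  - exists (Num.truncn (`|x| + t)).+1 => n v xn.
    apply: (cs_semigroup_local hU1 hlref v (f_M n) fM (mf_ n) mf (x0 := x) (T := t)) => //.
      move=> y w yx; rewrite /f_ /= ifT//.
      rewrite (@le_trans _ _ (`|x| + t))//.
        by rewrite -[y](subrK x) addrC (le_trans (ler_normD _ _))// lerD2l.
      by rewrite (le_trans (ltW (truncnS_gt _)))// ler_nat.
    by rewrite subrr normr0 add0r.
rewrite -!intRn_weighted_sum//; last 2 first.
- by move=> z; have /andP[] := cs_semigroup_bounds hU1 hlref fM t z.
- exact: mcs.
apply: (cvg_unique _ c2) => //.
rewrite (_ : (fun n => _) = (fun n => intRn (weighted_sum (f_ n))))//.
apply/funext => n; rewrite !intRn_weighted_sum//; last 2 first.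
- by move=> z; have /andP[] := cs_semigroup_bounds hU1 hlref (f_M n) t z.
- by apply: mcs.
apply: (invariance_bounded_support (f_M n) (mf_ n) (r := n%:R)) => // x v xn.
by rewrite /f_ /= ifF//; apply/negbTE; rewrite -ltNge.
Qed.

End invariance.

(** * Measures with a density, and Jordan parts *)

Section density.
Context {R : realType} (n : nat) (W : 'rV[R]_n -> R).
Context (mW : measurable_fun setT (W : BorelRd R n -> R)) (W0 : forall x, 0 <= W x).
Local Open Scope ereal_scope.

(** The indicator of [A] is written as a Dirac mass, so that sigma-additivity in [A] is inherited
    from a measure at each point. *)
Let dens (A : set (BorelRd R n)) : \bar R :=
  intRn (fun x : 'rV[R]_n => (W x)%:E * \d_(x : BorelRd R n) A).

Let mdens (A : set (BorelRd R n)) : measurable A ->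
  measurable_fun setT (fun x : BorelRd R n => (W x)%:E * \d_x A).
Proof.
move=> mA; apply: emeasurable_funM; first exact/measurable_EFinP.
by apply/measurable_EFinP; exact: measurable_indic.
Qed.

Let dens_ge0 (A : set (BorelRd R n)) : 0 <= dens A.
Proof. by apply: intRn_ge0 => x; rewrite mule_ge0// lee_fin. Qed.

Let dens0 : dens set0 = 0.
Proof.
by rewrite /dens -[RHS](intRn0 n); apply: eq_intRn => x; rewrite measure0 mule0.
Qed.

Let dens_sigma_additive : semi_sigma_additive dens.
Proof.
move=> F mF tF mUF.
pose f k (x : 'rV[R]_n) := (W x)%:E * \sum_(0 <= i < k) \d_(x : BorelRd R n) (F i).
have f0 k x : 0 <= f k x by rewrite mule_ge0 ?lee_fin// sume_ge0.
rewrite (_ : (fun k => _) = (fun k => intRn (f k))); last first.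
  apply/funext => k; rewrite -intRn_sum.
  - apply: eq_intRn => x; rewrite /f ge0_sume_distrr// => i _.
  - by move=> i; exact: mdens.
  - by move=> i x; rewrite mule_ge0// lee_fin.
rewrite (_ : dens _ = intRn (fun x => limn (f ^~ x))).
  apply: cvg_intRn => // [k|x].
    apply: emeasurable_funM; first exact/measurable_EFinP.
    apply: emeasurable_sum => i.
    by apply/measurable_EFinP; exact: measurable_indic.
  apply/nondecreasing_seqP => k; apply: lee_wpmul2l; first by rewrite lee_fin.
  by rewrite big_nat_recr//= leeDl.
apply: eq_intRn => x; apply/esym/cvg_lim => //.
apply: cvgeZl => //.
exact: (@measure_semi_sigma_additive _ _ _ (\d_(x : BorelRd R n)) F mF tF mUF).
Qed.

Import HBNNSimple.

(** [rho_int] is defined through iterated integrals, whereas uniqueness compares measures; this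
    turns the former into the latter, on simple functions and then by monotone limits. *)
Lemma density_measure_exists :
  exists m : {measure set (BorelRd R n) -> \bar R},
    forall g : BorelRd R n -> R, (forall x, 0 <= g x)%R -> measurable_fun setT g ->
      \int[m]_x (g x)%:E = intRn (fun x => (g x * W x)%:E).
Proof.
pose mix := isMeasure.Build _ (BorelRd R n) R dens dens0 dens_ge0 dens_sigma_additive.
pose m : {measure set (BorelRd R n) -> \bar R} := HB.pack dens mix.
have mE A : m A = dens A by [].
exists m => g g0 mg.
have meg : measurable_fun setT (EFin \o g) by exact/measurable_EFinP.
pose h := nnsfun_approx measurableT meg.
have hE k : \int[m]_x (h k x)%:E = intRn (fun x => (h k x * W x)%:E).
  pose r : seq R := fset_set (range (h k)).
  have hsum x : (h k x)%:E = \sum_(y <- r) (y * \1_(h k @^-1` [set y]) x)%:E.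
    by rewrite fimfunE fsbig_finite//= sumEFin.
  transitivity (\int[m]_x \sum_(y <- r) (y * \1_(h k @^-1` [set y]) x)%:E).
    by apply: eq_integral => x _; exact: hsum.
  rewrite ge0_integral_sum//; last 2 first.
  - move=> y; apply/measurable_EFinP; apply: measurable_funM => //.
  - by move=> y x _; exact: nnfun_muleindic_ge0.
  transitivity (\sum_(y <- r) intRn (fun x => (y * \1_(h k @^-1` [set y]) x)%:E * (W x)%:E)).
    rewrite big_seq [RHS]big_seq; apply: eq_bigr => y yr.
    have y0 : (0 <= y)%R.
      have : y \in fset_set (range (h k)) by [].
      have fr : finite_set (range (h k)) by [].
      by rewrite (in_fset_set fr) => /set_mem[x _ <-]; exact: fun_ge0.
    rewrite integralZl_indic_nnsfun// integral_indic// setIT mE /dens -intRnZl//.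
    - by apply: eq_intRn => x; rewrite diracE indicE EFinM -!muleA [(_ * (W x)%:E)%E]muleC.
    - exact: mdens.
    - by move=> x; rewrite mule_ge0// lee_fin.
  rewrite -intRn_sum.
  - apply: eq_intRn => x; rewrite EFinM hsum -ge0_sume_distrl// => y _.
    exact: nnfun_muleindic_ge0.
  - move=> y; apply: emeasurable_funM; last exact/measurable_EFinP.
    by apply/measurable_EFinP; apply: measurable_funM.
  - by move=> y x; rewrite mule_ge0// ?lee_fin//; exact: nnfun_muleindic_ge0.
have gE x : (g x)%:E = limn (fun k => (h k x)%:E).
  by apply/esym/cvg_lim => //; apply: (cvg_nnsfun_approx measurableT meg) => // y _; rewrite lee_fin.
have hnd x : nondecreasing_seq (fun k => (h k x)%:E).
  by move=> a b ab; rewrite lee_fin; exact/lefP/nd_nnsfun_approx.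
have c1 : \int[m]_x (h k x)%:E @[k --> \oo] --> \int[m]_x (g x)%:E.
  under [X in _ --> X]eq_integral do rewrite gE.
  apply: cvg_monotone_convergence => //.
  - by move=> k; apply/measurable_EFinP.
  - by move=> k x _; rewrite lee_fin.
apply: (cvg_unique _ c1) => //.
rewrite (_ : (fun k => _) = (fun k => intRn (fun x => (h k x * W x)%:E))); last exact/funext.
rewrite (_ : intRn (fun x => (g x * W x)%:E) =
    intRn (fun x => limn (fun k => (h k x * W x)%:E))).
  apply: (cvg_intRn (f := fun k x => (h k x * W x)%:E)) => // [k|k x|x].
  - by apply/measurable_EFinP; exact: measurable_funM.
  - by rewrite lee_fin mulr_ge0.
  - move=> a b ab; have := hnd x a b ab; rewrite !lee_fin => hab.
    exact: ler_wpM2r (W0 x) _ _ hab.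
apply: eq_intRn => x; apply/esym/cvg_lim => //.
under eq_fun do rewrite EFinM; rewrite EFinM; apply: cvgeMr => //.
rewrite gE; exact: (ereal_nondecreasing_is_cvgn (hnd x)).
Qed.

End density.

Section jordan.
Context d (T : measurableType d) {R : realType}.
Local Open Scope ereal_scope.

(** [p] and [n] are the Jordan parts of the charge m1 - m2 and [H] is its positive Hahn set. Adding
    [n] and [p] across the equation keeps it among nonnegative measures. *)
Lemma jordan_measures (m1 m2 : {measure set T -> \bar R}) :
  m1 setT < +oo -> m2 setT < +oo ->
  exists (p n : {measure set T -> \bar R}) (H : set T),
    [/\ measurable H, n H = 0, p (~` H) = 0, p setT < +oo & n setT < +oo] /\
    forall A, measurable A -> m1 A + n A = m2 A + p A.
Proof.
move=> m1fin m2fin.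
have fin (m : {measure set T -> \bar R}) : m setT < +oo -> fin_num_fun m.
  move=> mfin A mA; rewrite ge0_fin_numE// (le_lt_trans _ mfin)//.
  by apply: le_measure; [exact/mem_set|exact/mem_set/measurableT|].
pose c1 : {charge set T -> \bar R} := HB.pack (m1 : set T -> \bar R)
  (isCharge.Build _ T R m1 (measure0 m1) (fin m1 m1fin) (@measure_semi_sigma_additive _ _ _ m1)).
pose c2 : {charge set T -> \bar R} := HB.pack (m2 : set T -> \bar R)
  (isCharge.Build _ T R m2 (measure0 m2) (fin m2 m2fin) (@measure_semi_sigma_additive _ _ _ m2)).
pose nu : {charge set T -> \bar R} := cadd c1 (copp c2).
have [P [N PN]] := Hahn_decomposition nu.
have [[mP _] [mN _] PUN PIN] := PN.
pose p : {measure set T -> \bar R} := jordan_pos PN.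
pose n : {measure set T -> \bar R} := jordan_neg PN.
have pE A : measurable A -> p A = nu (A `&` P).
  move=> mA; etransitivity; first exact: (jordan_posE PN A).
  by rewrite cjordan_posE /crestr0 mem_set.
have nE A : measurable A -> n A = - nu (A `&` N).
  move=> mA; etransitivity; first exact: (jordan_negE PN A).
  by rewrite cjordan_negE /crestr0 mem_set.
have pfin A : measurable A -> p A \is a fin_num.
  by move=> mA; exact: (@fin_num_measure _ _ _ (jordan_pos PN)).
have nfin A : measurable A -> n A \is a fin_num.
  by move=> mA; exact: (@fin_num_measure _ _ _ (jordan_neg PN)).
have E A : measurable A -> m1 A - m2 A = p A - n A.
  move=> mA; rewrite pE// nE// oppeK; transitivity (nu A) => //.
  exact: charge_partition.
clearbody p n; exists p, n, P; split; first split => //.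
- by rewrite nE// PIN charge0 oppe0.
- by rewrite pE ?setICl ?charge0//; exact: measurableC.
- by rewrite -ge0_fin_numE// pfin.
- by rewrite -ge0_fin_numE// nfin.
- move=> A mA; move: (E A mA) (fin m1 m1fin A mA) (fin m2 m2fin A mA) (pfin A mA) (nfin A mA).
  move: (m1 A) (m2 A) (p A) (n A).
  move=> [a| |] [b| |] [r| |] [q| |]//=; rewrite -!EFinB => -[e] _ _ _ _.
  by rewrite -!EFinD; congr EFin; lra.
Qed.

End jordan.

(** * Steering two trajectories to a common point *)

Section control.
Context {R : realType} {d : nat} (U : 'rV[R]_d -> R) (hU1 : C1 U).
Context (lref : R) (hlref : 0 < lref).
Implicit Types (x y X Y : 'rV[R]_d) (v w : vel d) (t s a b c : R).
Implicit Types (f g h : 'rV[R]_d * vel d -> R).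
Notation mu := (@lebesgue_measure R).
Local Notation ra := (rate U lref).
Local Notation La := (Lambda U lref).
Local Notation Q := (Qop U lref).
Local Notation cs := (cs_semigroup U lref).
Local Notation mtest f :=
  (forall w, measurable_fun setT (fun x : BorelRd R d => f (x, w))).

(* Every velocity has a positive chance at every event, and the event rate is
   positive, so a vanishing expectation vanishes along almost all jump times. *)
Lemma cs_zero g (M : R) t x v : (forall z, 0 <= g z <= M) -> mtest g -> 0 <= t ->
  cs t g (x, v) = 0 -> g (x + t *: vvec R v, v) = 0 /\
  {ae mu, forall s : R, `[0%R, t]%classic s ->
     forall w, cs (t - s) g (x + s *: vvec R v, w) = 0}.
Proof.
move=> gM mg t0 E; have := cs_semigroup_solves hU1 hlref gM mg x v t0.
rewrite E /renewal; set I := (\int[mu]_(s in _) _)%E.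
have I0 : (0 <= I)%E.
  apply: integral_ge0 => s _; rewrite lee_fin.
  apply: (renewal_integrand_ge0 U hlref (u := fun t => cs t g)) => w.
  by have /andP[] := cs_semigroup_bounds hU1 hlref gM (t - s) (x + s *: vvec R v, w).
have g0 : 0 <= g (x + t *: vvec R v, v) by have /andP[] := gM (x + t *: vvec R v, v).
move=> /esym/eqP; rewrite padde_eq0//; last by rewrite lee_fin mulr_ge0 ?expR_ge0.
rewrite eqe mulf_eq0 (gt_eqF (expR_gt0 _)) orbF => /andP[/eqP gz /eqP Iz].
split => //.
have := ge0_integral_eq0_ae (m := mu) (measurable_itv _) _ _ Iz.
have mI : measurable_fun `[0%R, t]%classic (fun s : measurableTypeR R =>
    (jump_density U lref x v s * Q (cs (t - s) g) (x + s *: vvec R v))%:E).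
  apply: measurable_funTS.
  apply: (measurable_renewal_integrand hU1 hlref (u := fun t => cs t g) v (T := measurableTypeR R)
    (t := fun=> t) (s := id) (p := fun=> x)) => //.
  exact: cs_semigroup_jmeas gM mg.
have nI s : `[0%R, t]%classic s ->
   (0 <= (jump_density U lref x v s * Q (cs (t - s) g) (x + s *: vvec R v))%:E)%E.
  move=> _; rewrite lee_fin.
  apply: (renewal_integrand_ge0 U hlref (u := fun t => cs t g)) => w.
  by have /andP[] := cs_semigroup_bounds hU1 hlref gM (t - s) (x + s *: vvec R v, w).
move=> /(_ mI nI); apply: filterS => s /[apply] -[] /eqP.
rewrite mulf_eq0 gt_eqF /=; last by rewrite mulr_gt0 ?expR_gt0// rate_gt0.
rewrite /Qop psumr_eq0; last first.
  move=> w _; rewrite mulr_ge0 ?jump_prob_ge0//.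
  by have /andP[] := cs_semigroup_bounds hU1 hlref gM (t - s) (x + s *: vvec R v, w).
move=> /allP h w; have := h w (mem_index_enum _).
by rewrite /= mulf_eq0 (gt_eqF (jump_prob_gt0 U hlref _ _)) /= => /eqP.
Qed.

Lemma ae_shift (P : R -> Prop) c :
  {ae mu, forall s, P s} -> {ae mu, forall s, P (s + c)}.
Proof.
move=> [N [mN N0 PN]].
have mc : measurable_fun setT ((fun s => s + c) : measurableTypeR R -> measurableTypeR R).
  exact: measurable_funD.
exists ((fun s => s + c) @^-1` N); split.
- by rewrite -[X in measurable X]setTI; exact: mc.
- have mS : measurable ((fun s => s + c) @^-1` N).
    by rewrite -[X in measurable X]setTI; exact: mc.
  transitivity (mu ((fun s => s + c) @^-1` N `&` setT)); first by rewrite setIT.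
  rewrite -(integral_indic mu measurableT mS).
  transitivity (\int[mu]_s (\1_N (s + c))%:E)%E.
    by apply: eq_integral => s _; rewrite !indicE.
  rewrite (lebesgue_integral_shift (f := fun s => (\1_N s)%:E)).
  + by rewrite (integral_indic mu measurableT mN) setIT.
  + by apply/measurable_EFinP; exact: measurable_indic.
  + by move=> s; rewrite lee_fin.
- by move=> s Ps; apply: PN.
Qed.

Section pair.
Context (g h : 'rV[R]_d * vel d -> R) (M : R).
Context (gM : forall z, 0 <= g z <= M) (hM : forall z, 0 <= h z <= M).
Context (mg : mtest g) (mh : mtest h).

(** [c] is the excess of the first duration over the second. For almost every [s'] in a window of
    length one, both [s'] and [s' + c] are good jump times, and after these jumps every velocity is
    available to both trajectories. *)
Lemma common_time X Y v w a b c :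
  cs a g (X, v) = 0 -> cs b h (Y, w) = 0 -> `|c| + 1 <= a -> `|c| + 1 <= b ->
  exists s s' : R, [/\ 0 <= s <= `|c| + 1, 0 <= s' <= `|c| + 1, s = s' + c,
    forall u, cs (a - s) g (X + s *: vvec R v, u) = 0 &
    forall u, cs (b - s') h (Y + s' *: vvec R w, u) = 0].
Proof.
move=> gX hY ca cb.
have c0 := normr_ge0 c.
have [_ aeg] := cs_zero gM mg (le_trans (addr_ge0 c0 ler01) ca) gX.
have [_ aeh] := cs_zero hM mh (le_trans (addr_ge0 c0 ler01) cb) hY.
(* The least [s'] for which [s'] and [s' + c] are both nonnegative. *)
pose m := Num.max 0 (- c).
have m0 : 0 <= m by rewrite le_max lexx.
have mc : - c <= m by rewrite le_max lexx orbT.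
have mabs : m <= `|c| by rewrite ge_max c0 /= -normrN ler_norm.
have mcabs : m + c <= `|c|.
  by rewrite /m; have [_|_] := leP (- c) 0; rewrite ?add0r ?ler_norm// addNr.
have aegh : {ae mu, forall s' : R, `[m, m + 1]%classic s' ->
   (forall u, cs (a - (s' + c)) g (X + (s' + c) *: vvec R v, u) = 0) /\
   (forall u, cs (b - s') h (Y + s' *: vvec R w, u) = 0)}.
  have aeF : Filter (almost_everywhere mu) := ae_filter_ringOfSetsType mu.
  apply: (@filterS _ _ aeF _ _ _ (@filterI _ _ aeF _ _ (ae_shift c aeg) aeh)) => s' [h1 h2] /=.
  rewrite in_itv/= => /andP[ms sm]; split.
    by apply: h1; rewrite /= in_itv/=; apply/andP; split; lra.
  by apply: h2; rewrite /= in_itv/=; apply/andP; split; lra.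
have [||//|s' + [h1 h2]] := ae_exists (m := mu)
    (A := `[m, m + 1]%classic : set (measurableTypeR R)) _ _ _ aegh.
- exact: measurable_itv.
- by rewrite /= lebesgue_measure_itv/= lte_fin ltrDl ltr01 -EFinB lte_fin; lra.
rewrite /= in_itv/= => /andP[ms sm]; exists (s' + c), s'; split => //.
- by apply/andP; split; lra.
- by apply/andP; split; lra.
Qed.

(* Both trajectories are steered to a common point, coordinate by coordinate;
   a final reversal along the last coordinate absorbs the remaining times. *)
Lemma common_zero x y v w : (0 < d)%N ->
  exists T : R, forall t, T <= t -> cs t g (x, v) = 0 -> cs t h (y, w) = 0 ->
  exists z, g z = 0 /\ h z = 0.
Proof.
move=> d0.
(* Each trajectory moves by at most 1 before its first jump, so [D] bounds all coordinate gaps from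
   then on. *)
pose D := `|x - y| + 2.
have D0 : 0 <= D by rewrite addr_ge0.
(* Time budget: 1 for the first jump, at most [D + 1] for each alignment, and [D + d D + 1] for the
   last adjustment, with 1 to spare. *)
exists (1 + d%:R * (D + 1) + (D + d%:R * D) + 2) => t tT gx hy.
have dD0 : 0 <= d%:R * D by rewrite mulr_ge0.
have dD1 : 0 <= d%:R * (D + 1) by rewrite mulr_ge0// addr_ge0.
(* The remaining times [a] and [b] are tracked separately: each alignment changes their difference
   by the gap it closes, at most [D]. *)
have align k : (k <= d.-1)%N -> exists X Y a b,
  [/\ forall u, cs a g (X, u) = 0, forall u, cs b h (Y, u) = 0,
      forall j : 'I_d, (j < k)%N -> X 0 j = Y 0 j,
      forall j : 'I_d, (k <= j)%N -> `|X 0 j - Y 0 j| <= D &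
      [/\ t - 1 - k%:R * (D + 1) <= a, t - 1 - k%:R * (D + 1) <= b & `|a - b| <= k%:R * D]].
  elim: k => [_|k IH kd].
    have [||s [s' [/andP[s0 s1] /andP[s'0 s'1] ss' gs hs]]] :=
        common_time (c := 0) gx hy; rewrite ?normr0; try lra.
    rewrite normr0 in s1 s'1.
    exists (x + s *: vvec R v), (y + s' *: vvec R w), (t - s), (t - s'); split => //.
    - move=> j _; have E : (x + s *: vvec R v) 0 j - (y + s' *: vvec R w) 0 j =
         (x - y) 0 j + (s *: vvec R v) 0 j - (s' *: vvec R w) 0 j by rewrite !mxE; ring.
      rewrite E (le_trans (ler_normB _ _))// (le_trans (lerD (ler_normD _ _) (lexx _)))//.
      rewrite /D -addrA; apply: lerD; first exact: coord_le_norm.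
      have step (r : R) (u : vel d) : 0 <= r <= 1 -> `|(r *: vvec R u) 0 j| <= 1.
        move=> /andP[r0 r1]; rewrite mxE normrM ger0_norm// (le_trans _ r1)// ler_piMr//.
        by rewrite (le_trans (coord_le_norm _ _))// vvec_norm.
      have := step s v; have := step s' w; rewrite s0 s'0 !add0r in s1 s'1 *.
      by rewrite s1 s'1 => /(_ isT) h1 /(_ isT) h2; lra.
    - rewrite add0r in s1 s'1; rewrite !mul0r subr0 ss' addr0 subrr normr0.
      by split => //; lra.
  have [X [Y [a [b [gX hY XY XYD [ta tb ab]]]]]] := IH (ltnW kd).
  have kd' : (k < d)%N by rewrite (leq_trans kd)// leq_pred.
  pose i := Ordinal kd'.
  pose c := Y 0 i - X 0 i.
  have cD : `|c| <= D by rewrite /c distrC XYD.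
  have kdR : k.+1%:R <= d%:R :> R by rewrite ler_nat.
  have kD : k%:R * (D + 1) + (D + 1) <= d%:R * (D + 1).
    by rewrite -{2}[D + 1]mul1r -mulrDl natr1 ler_wpM2r// addr_ge0.
  (* Both move along +e_i, with s - s' equal to the gap, so that X_i + s = Y_i + s'. *)
  have [||s [s' [/andP[s0 s1] /andP[s'0 s'1] ss' gs hs]]] :=
      common_time (c := c) (gX (i, true)) (hY (i, true)); try lra.
  exists (X + s *: vvec R (i, true)), (Y + s' *: vvec R (i, true)), (a - s), (b - s'); split => //.
  - move=> j jk; rewrite !mxE !eqxx !mul1r.
    have [->|ji] := eqVneq j i; first by rewrite /= !mulr1 ss' /c; ring.
    rewrite /= !mulr0 !addr0; apply: XY.
    by move: jk; rewrite ltnS leq_eqVlt => /predU1P[jk|//]; case/eqP: ji; exact: val_inj.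
  - move=> j kj; rewrite !mxE !eqxx !mul1r.
    have -> : (j == i) = false.
      by apply/eqP => ji; move: kj; rewrite ji /= ltnn.
    by rewrite !mulr0 !addr0 XYD// ltnW.
  - have e1 : k.+1%:R * (D + 1) = k%:R * (D + 1) + (D + 1) by rewrite -natr1 mulrDl mul1r.
    have e2 : k.+1%:R * D = k%:R * D + D by rewrite -natr1 mulrDl mul1r.
    rewrite e1 e2; split; [lra|lra|].
    rewrite (_ : a - s - (b - s') = (a - b) - c); last by rewrite ss'; ring.
    by rewrite (le_trans (ler_normB _ _))// lerD.
have [X [Y [a [b [gX hY XY XYD [ta tb ab]]]]]] := align d.-1 (leqnn _).
have dd : (d.-1 < d)%N by rewrite prednK.
pose i := Ordinal dd.
(* Moving along +e_i for [s] and [s'], then along -e_i for all remaining time, ends at X_i + 2 s - a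
   and Y_i + 2 s' - b; these agree exactly when s - s' is this [c]. *)
pose c := (Y 0 i - X 0 i + (a - b)) / 2.
have dR : d.-1%:R <= d%:R :> R by rewrite ler_nat leq_pred.
have d1 : d.-1%:R * (D + 1) <= d%:R * (D + 1) by rewrite ler_wpM2r// addr_ge0.
have d2 : d.-1%:R * D <= d%:R * D by rewrite ler_wpM2r.
have cD : `|c| <= D + d%:R * D.
  rewrite /c normrM [X in _ * X]ger0_norm ?invr_ge0//.
  have := ler_normD (Y 0 i - X 0 i) (a - b); have := XYD i (leqnn _).
  by rewrite distrC; have := normr_ge0 (Y 0 i - X 0 i + (a - b)); lra.
have [||s [s' [/andP[s0 s1] /andP[s'0 s'1] ss' gs hs]]] :=
    common_time (c := c) (gX (i, true)) (hY (i, true)); try lra.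
(* On the last leg no jump is used: the no-jump term makes the test functions themselves vanish at
   the end point. *)
have [|gz _] := cs_zero gM mg _ (gs (i, false)); first by lra.
have [|hz _] := cs_zero hM mh _ (hs (i, false)); first by lra.
eexists; split; first exact: gz.
rewrite -[RHS]hz; congr (h (_, _)); apply/rowP => j.
rewrite !mxE !eqxx; have [->|ji] := eqVneq j i.
  by rewrite /vsign /= ss' /c; field.
rewrite /= !mulr0 !addr0; apply: XY.
rewrite ltn_neqAle -ltnS prednK// ltn_ord andbT.
by apply: contra_neq ji => ji; exact: val_inj.
Qed.

End pair.

End control.

(** Used with a = m2(g), D the mass of p, b = n(P_k g), c = p(P_k g) and e = p(1 - P_k g). The two
    balances give b + e = 0, and finiteness of [a] and [D] forces the rest to be real. *)
Lemma adde_balance_eq0 (R : realType) (a b c e D : \bar R) :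
  (a \is a fin_num -> D \is a fin_num -> 0 <= b -> 0 <= c -> 0 <= e ->
  a + D + b = a + c -> c + e = D -> b = 0 /\ e = 0)%E.
Proof.
move: a D b c e => [a| |]//[D| |]//[b| |]//[c| |]//[e| |]// _ _.
rewrite !lee_fin => b0 c0 e0 [E1] [E2].
by split; apply: (congr1 EFin (y := 0%R)); lra.
Qed.

(** * Uniqueness of the invariant distribution *)

Section uniqueness.
Context {R : realType} {d : nat} (U : 'rV[R]_d -> R) (hU1 : C1 U).
Context (lref : R) (hlref : 0 < lref).
Local Notation cs := (cs_semigroup U lref).
Local Notation test01 f := ((forall z, 0 <= f z <= 1)%R /\
  forall w, measurable_fun setT (fun x : BorelRd R d => f (x, w))).
Local Open Scope ereal_scope.

Definition family_integral (m : vel d -> {measure set (BorelRd R d) -> \bar R})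
  (f : 'rV[R]_d * vel d -> R) : \bar R := \sum_(v : vel d) \int[m v]_x (f (x, v))%:E.

Implicit Types f g h : 'rV[R]_d * vel d -> R.
Implicit Types m : vel d -> {measure set (BorelRd R d) -> \bar R}.

Lemma family_integral_ge0 m f : (forall z, 0 <= f z)%R -> 0 <= family_integral m f.
Proof. by move=> f0; apply: sume_ge0 => v _; apply: integral_ge0 => x _; rewrite lee_fin. Qed.

Lemma family_integralD m f g : (forall z, 0 <= f z)%R -> (forall z, 0 <= g z)%R ->
  (forall w, measurable_fun setT (fun x : BorelRd R d => f (x, w))) ->
  (forall w, measurable_fun setT (fun x : BorelRd R d => g (x, w))) ->
  family_integral m (fun z => f z + g z)%R = family_integral m f + family_integral m g.
Proof.
move=> f0 g0 mf mg; rewrite -big_split; apply: eq_bigr => v _ /=.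
rewrite -ge0_integralD//.
- by move=> x _; rewrite lee_fin.
- by apply/measurable_EFinP; exact: mf.
- by move=> x _; rewrite lee_fin.
- by apply/measurable_EFinP; exact: mg.
Qed.

Lemma family_integral1 m : family_integral m (fun=> 1%R) = \sum_v m v setT.
Proof.
apply: eq_bigr => v _.
by have := integral_cst (m v) (measurableT : measurable [set: BorelRd R d]) 1; rewrite mul1e.
Qed.

Lemma family_mass_fin m v : \sum_v m v setT < +oo -> m v setT < +oo.
Proof.
by apply: le_lt_trans; rewrite (bigD1 v)//= leeDl// sume_ge0.
Qed.

Lemma family_integral_eq0_ae m f : (forall z, 0 <= f z)%R ->
  (forall w, measurable_fun setT (fun x : BorelRd R d => f (x, w))) ->
  family_integral m f = 0 -> forall v, {ae m v, forall x, f (x, v) = 0%R}.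
Proof.
move=> f0 mf E v.
have Ev : \int[m v]_x (f (x, v))%:E = 0.
  move/eqP: E; rewrite seq_psume_eq0; last first.
    by move=> w _; apply: integral_ge0 => x _; rewrite lee_fin.
  by move=> /allP h; apply/eqP; exact: (h v (mem_index_enum _)).
have := ge0_integral_eq0_ae (m := m v) measurableT _ _ Ev.
have mfv : measurable_fun setT (fun x : BorelRd R d => (f (x, v))%:E).
  by apply/measurable_EFinP; exact: mf.
move=> /(_ mfv (fun x _ => f0 (x, v))).
by apply: filterS => x /(_ Logic.I) [].
Qed.

Lemma exists_positive m : \sum_v m v setT != 0 -> exists v, 0 < m v setT.
Proof.
apply: contraPP => /forallNP h; apply/negP; rewrite negbK; apply/eqP.
apply: big1 => v _; apply/eqP; rewrite eq_le measure_ge0 andbT.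
by rewrite leNgt; exact/negP.
Qed.

(* Jordan decomposition of the difference: its positive and negative parts are
   both invariant, and the semigroup cannot keep them apart. *)
Lemma invariant_unique m1 m2 : (0 < d)%N ->
  \sum_v m1 v setT = 1 -> \sum_v m2 v setT = 1 ->
  (forall t f, (0 <= t)%R -> test01 f ->
    family_integral m1 (cs t f) = family_integral m1 f) ->
  (forall t f, (0 <= t)%R -> test01 f ->
    family_integral m2 (cs t f) = family_integral m2 f) ->
  forall v (A : set (BorelRd R d)), measurable A -> m1 v A = m2 v A.
Proof.
move=> d0 mass1 mass2 inv1 inv2.
have fin1 v : m1 v setT < +oo by apply: family_mass_fin; rewrite mass1 ltry.
have fin2 v : m2 v setT < +oo by apply: family_mass_fin; rewrite mass2 ltry.
have /choice[p /choice[n /choice[H J]]] :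
  forall v, exists (p n : {measure set (BorelRd R d) -> \bar R}) (H : set (BorelRd R d)),
    [/\ measurable H, n H = 0, p (~` H) = 0, p setT < +oo & n setT < +oo] /\
    forall A, measurable A -> m1 v A + n A = m2 v A + p A.
  by move=> v; exact: jordan_measures.
have mH v : measurable (H v) by have [[]] := J v.
have pn_int f : (forall z, 0 <= f z)%R ->
    (forall w, measurable_fun setT (fun x : BorelRd R d => f (x, w))) ->
    family_integral m1 f + family_integral n f = family_integral m2 f + family_integral p f.
  move=> f0 mf; rewrite -!big_split; apply: eq_bigr => v _ /=.
  have mfv : measurable_fun setT (fun x : BorelRd R d => (f (x, v))%:E).
    by apply/measurable_EFinP; exact: mf.
  rewrite -!ge0_integral_measure_add//; try by move=> x _; rewrite lee_fin.
  apply: eq_measure_integral => A mA _; have [_ /(_ A mA) E] := J v.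
  have addE (m m' : {measure set (BorelRd R d) -> \bar R}) : measure_add m m' A = m A + m' A.
    exact: measure_addE.
  by etransitivity; [exact: addE|rewrite E; exact/esym/addE].
pose g (z : 'rV[R]_d * vel d) : R := \1_(H z.2) (z.1 : BorelRd R d).
have g01 z : (0 <= g z <= 1)%R by rewrite /g indicE; case: (_ \in _); rewrite /= lexx ler01.
have mg w : measurable_fun setT (fun x : BorelRd R d => g (x, w)).
  by apply: measurable_indic; exact: mH.
have g0 z : (0 <= g z)%R by have /andP[] := g01 z.
(* The time needed for steering depends on the starting points, which are chosen beforehand. With
   integer times the exceptional sets are countably many, and one starting point avoids them all. *)
pose P k := cs k%:R g.
have P01 k z : (0 <= P k z <= 1)%R := cs_semigroup_bounds hU1 hlref g01 k%:R z.
have P0 k z : (0 <= P k z)%R by have /andP[] := P01 k z.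
have mP k w : measurable_fun setT (fun x : BorelRd R d => P k (x, w)).
  exact: (measurable_joint w (cs_semigroup_jmeas hU1 hlref g01 mg) (s := fun=> k%:R) (p := id)).
have Q0 k z : (0 <= 1 - P k z)%R by have /andP[_] := P01 k z; rewrite subr_ge0.
have mQ k w : measurable_fun setT (fun x : BorelRd R d => 1 - P k (x, w))%R.
  by apply: measurable_funB => //; exact: mP.
pose D := \sum_v p v setT.
have ng : family_integral n g = 0.
  apply: big1 => v _; rewrite (integral_indic _ measurableT (mH v)) setIT.
  by have [[]] := J v.
have pg : family_integral p g = D.
  apply: eq_bigr => v _; rewrite (integral_indic _ measurableT (mH v)) setIT.
  have [[_ _ pH _ _] _] := J v.
  have := measureU (p v) (mH v) (measurableC (mH v)) (setICr (H v)).
  by rewrite setUv => ->; rewrite [X in _ + X]pH adde0.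
have Dfin : D \is a fin_num.
  rewrite ge0_fin_numE ?sume_ge0//; apply: lte_sum_pinfty => v _.
  by have [[]] := J v.
(* Equal total masses give [p] and [n] the same mass, so both kinds of starting points exist as soon
   as [D] is nonzero. *)
have nD : \sum_v n v setT = D.
  have := pn_int (fun=> 1%R) (fun=> ler01) (fun w => measurable_cst _).
  rewrite !family_integral1 mass1 mass2 => /eqP.
  by rewrite eq_le => /andP[]; rewrite !leeD2lE// => h1 h2; apply/eqP; rewrite eq_le h1 h2.
have sub1 m k : family_integral m (P k) + family_integral m (fun z => 1 - P k z)%R =
    \sum_v m v setT.
  rewrite -family_integralD// -family_integral1; apply: eq_bigr => v _.
  by apply: eq_integral => x _; rewrite addrC subrK.
have [nP pQ] : (forall k, family_integral n (P k) = 0) /\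
    (forall k, family_integral p (fun z => 1 - P k z)%R = 0).
  suff key k : family_integral n (P k) = 0 /\
      family_integral p (fun z => 1 - P k z)%R = 0.
    by split=> k; have [] := key k.
  have Eg := pn_int g g0 mg; have EP := pn_int (P k) (P0 k) (mP k).
  rewrite ng adde0 pg in Eg.
  (* Invariance removes the semigroup from the [m1] and [m2] terms, and [Eg] leaves m2(g) + D +
     n(P_k g) = m2(g) + p(P_k g). *)
  rewrite (inv1 k%:R g)// (inv2 k%:R g)// Eg in EP.
  have S2fin : family_integral m2 g \is a fin_num.
    rewrite ge0_fin_numE ?family_integral_ge0//.
    apply: (@le_lt_trans _ _ 1); last by rewrite ltry.
    rewrite -mass2 -family_integral1; apply: lee_sum => v _.
    apply: ge0_le_integral => //.
    - by move=> x _; rewrite lee_fin.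
    - by apply/measurable_EFinP; exact: mg.
    - by move=> x _; rewrite lee_fin; have /andP[] := g01 (x, v).
  exact: (adde_balance_eq0 S2fin Dfin (family_integral_ge0 n (P0 k))
    (family_integral_ge0 p (P0 k)) (family_integral_ge0 p (Q0 k)) EP (sub1 p k)).
have [D0|D0] := eqVneq D 0.
  move=> v A mA; have [_ /(_ A mA)] := J v.
  have z0 (m : {measure set (BorelRd R d) -> \bar R}) : m setT = 0 -> m A = 0.
    move=> mT; apply/eqP; rewrite eq_le measure_ge0 andbT -mT.
    by apply: le_measure; [exact/mem_set|exact/mem_set/measurableT|].
  have sum0 (m : vel d -> {measure set (BorelRd R d) -> \bar R}) :
      \sum_v m v setT = 0 -> m v setT = 0.
    move=> /eqP; rewrite seq_psume_eq0// => /allP h; apply/eqP.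
    exact: (h v (mem_index_enum _)).
  have -> : n v A = 0 by apply: z0; apply: sum0; rewrite nD.
  have -> : p v A = 0 by apply: z0; exact: sum0.
  by rewrite !adde0.
have [v pv] : exists v, 0 < p v setT by exact: exists_positive.
have [w nw] : exists w, 0 < n w setT by apply: exists_positive; rewrite nD.
have [y _ yP] : exists2 y : BorelRd R d, setT y & forall k, P k (y, w) = 0%R.
  apply: (ae_exists measurableT nw (D := setT)) => //.
  have /ae_foralln : forall k, {ae n w, forall x, P k (x, w) = 0%R}.
    by move=> k; apply: family_integral_eq0_ae.
  by apply: filterS => x h _.
have [x _ xQ] : exists2 x : BorelRd R d, setT x & forall k, (1 - P k (x, v) = 0)%R.
  apply: (ae_exists measurableT pv (D := setT)) => //.
  have /ae_foralln : forall k, {ae p v, forall x, (1 - P k (x, v) = 0)%R}.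
    move=> k; exact: (family_integral_eq0_ae (f := fun z => 1 - P k z)%R).
  by apply: filterS => x' h _.
have h01 z : (0 <= 1 - g z <= 1)%R.
  by have /andP[? ?] := g01 z; apply/andP; split; lra.
have mh u : measurable_fun setT (fun x : BorelRd R d => 1 - g (x, u))%R.
  by apply: measurable_funB => //; exact: mg.
have [T TP] := common_zero hU1 hlref g01 h01 mg mh y x w v d0.
pose k := (Num.truncn T).+1.
have [|||z [gz hz]] := TP k%:R.
- by rewrite ltW// truncnS_gt.
- exact: yP.
(* Conservation of mass turns P_k g = 1 at [x] into a vanishing expectation of [1 - g]. *)
- have := cs_semigroup_onem hU1 hlref (x, v) g01 mg (ler0n R k); rewrite -/(P k (x, v)).
  by have := xQ k; lra.
by exfalso; move: gz hz; lra.
Qed.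

End uniqueness.

(** * Normalisation of [rho], and its identification with any invariant probability *)

Theorem theorem3 (R : realType) (d : nat) (hd : (1 <= d)%N)
  (U : 'rV[R]_d -> R) (hU0 : forall x, 0 <= U x) (hU1 : C1 U)
  (hUint : (intRn (fun x => (expR (- U x))%:E) < +oo)%E)
  (lref : R) (hlref : 0 < lref) :
  (* the transition semigroup of the Coordinate Sampler exists *)
  (exists P, CS_semigroup U lref P) /\
  (forall P, CS_semigroup U lref P ->
    (* rho = pi (x) phi is invariant *)
    (forall (t : R) (f : 'rV[R]_d * vel d -> R), 0 <= t -> testfun f ->
       rho_int U (P t f) = rho_int U f) /\
    (* uniqueness: any invariant probability distribution mu on R^d x V
       (given by its restrictions mu v = mu( . x {v}) ) equals rho *)
    (forall mu : vel d -> {measure set (BorelRd R d) -> \bar R},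
       (\sum_(v : vel d) mu v setT = 1)%E ->
       (forall (t : R) (f : 'rV[R]_d * vel d -> R), 0 <= t -> testfun f ->
          (\sum_(v : vel d) \int[mu v]_x (P t f (x, v))%:E
           = \sum_(v : vel d) \int[mu v]_x (f (x, v))%:E)%E) ->
       forall (v : vel d) (A : set (BorelRd R d)), measurable A ->
         mu v A = rho_int U (fun z => \1_(A `*` [set v]) z))).
Proof.
pose cs := cs_semigroup U lref.
pose w (x : 'rV[R]_d) := expR (- U x).
have w0 x : 0 <= w x := expR_ge0 _.
have mw : measurable_fun setT (w : BorelRd R d -> R) := measurable_expNU hU1.
have csE P t f : CS_semigroup U lref P -> 0 <= t -> testfun f -> P t f = cs t f.
  by move=> PCS t0 ft; apply/funext => z; exact: (CS_semigroup_unique hU1 hlref z PCS t0 ft).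
have inv t f : 0 <= t -> testfun f ->
    (\sum_(v : vel d) intRn (fun x => (cs t f (x, v) * w x)%:E) =
     \sum_(v : vel d) intRn (fun x => (f (x, v) * w x)%:E))%E.
  by move=> t0 [[M fM] mf]; exact: (cs_invariant hU1 hlref t0 fM mf hUint).
split; first by exists cs; exact: CS_semigroup_exists.
move=> P PCS; split=> [t f t0 ft|mu mass inv_mu v A mA].
  by rewrite (csE P)// /rho_int inv.
have Zpos : 0 < Zconst U.
  have := intRn_gt0 (f := fun x => (w x)%:E) ((measurable_EFinP _ _).2 mw)
    (fun x => expR_gt0 _).
  by rewrite /Zconst => Z0; apply: fine_gt0; rewrite Z0.
have ZE : intRn (fun x => (w x)%:E) = (Zconst U)%:E.
  rewrite /Zconst fineK// ge0_fin_numE//.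
  by apply: intRn_ge0 => x; rewrite lee_fin.
pose c := ((2 * d)%:R * Zconst U)^-1.
have dpos : 0 < (2 * d)%:R :> R by rewrite ltr0n muln_gt0.
have c0 : 0 <= c by rewrite invr_ge0 mulr_ge0 ?ltW.
have mW : measurable_fun setT ((fun x => c * w x) : BorelRd R d -> R).
  exact: measurable_funM.
(* [rho] has the same restriction to every velocity, with density [c] e^-U, so the constant family
   [fun=> nu] represents it. *)
have [nu nuE] := density_measure_exists mW (fun x => mulr_ge0 c0 (w0 x)).
have nucE (g : BorelRd R d -> R) : (forall x, 0 <= g x) -> measurable_fun setT g ->
    (\int[nu]_x (g x)%:E = c%:E * intRn (fun x => (g x * w x)%:E))%E.
  move=> g0 mg; rewrite nuE// -intRnZl//.
  - by apply: eq_intRn => x; rewrite -EFinM mulrCA.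
  - by apply/measurable_EFinP; exact: measurable_funM.
  - by move=> x; rewrite lee_fin mulr_ge0.
have nu_int (f : 'rV[R]_d * vel d -> R) : (forall z, 0 <= f z) ->
    (forall u, measurable_fun setT (fun x : BorelRd R d => f (x, u))) ->
    family_integral (fun=> nu) f =
    (c%:E * \sum_(u : vel d) intRn (fun x => (f (x, u) * w x)%:E))%E.
  move=> f0 mf; rewrite ge0_sume_distrr; last first.
    by move=> u _; apply: intRn_ge0 => x; rewrite lee_fin mulr_ge0.
  by apply: eq_bigr => u _; exact: nucE.
have test1 (f : 'rV[R]_d * vel d -> R) : (forall z, 0 <= f z <= 1) /\
    (forall u, measurable_fun setT (fun x : BorelRd R d => f (x, u))) -> testfun f.
  by move=> [f01 mf]; split=> //; exists 1.
have test_ge0 (f : 'rV[R]_d * vel d -> R) : testfun f -> (forall z, 0 <= f z) /\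
    (forall u, measurable_fun setT (fun x : BorelRd R d => f (x, u))).
  by move=> [[M fM] mf]; split=> // z; have /andP[] := fM z.
have mass_nu : (\sum_(u : vel d) nu setT = 1)%E.
  rewrite -(family_integral1 (fun=> nu)) nu_int//.
  under eq_bigr do under eq_intRn do rewrite mul1r.
  rewrite big_const card_prod card_ord card_bool mulnC.
  rewrite (_ : iter _ _ _ = ((2 * d)%:R * Zconst U)%:E).
    by rewrite -EFinM mulVf// mulf_neq0// gt_eqF.
  elim: (2 * d)%N => [|k IH]; first by rewrite mul0r.
  by rewrite iterS IH ZE -EFinD -natr1 mulrDl mul1r addrC.
rewrite (@invariant_unique _ _ U hU1 lref hlref mu (fun=> nu) hd mass mass_nu _ _ v A mA).
- have := nucE (\1_A) (fun x => _) (measurable_indic mA).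
  rewrite integral_indic// setIT => ->//.
  (* The indicator kills every summand except that of [v]. *)
  rewrite /rho_int (bigD1 v)//= [X in (_ + X)%E]big1 ?adde0.
    congr (_ * _)%E; apply: eq_intRn => x; congr (_ * _)%:E.
    by rewrite !indicE; congr (nat_of_bool _)%:R; apply/idP/idP => [/set_mem xA|/set_mem[]xA _]; exact/mem_set.
  move=> u uv; rewrite -[RHS](@intRn0 R d); apply: eq_intRn => x.
  by rewrite indicE memNset ?mul0r// => -[_ /= E]; rewrite E eqxx in uv.
- by move=> t f t0 /test1 ft; rewrite -[RHS](inv_mu t f t0 ft) (csE P t f PCS t0 ft).
- move=> t f t0 /test1 ft; have [f0 mf] := test_ge0 f ft.
  have [ct _] := CS_semigroup_exists hU1 hlref t0 ft.
  have [cs0 mcs] := test_ge0 _ ct.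
  by rewrite !nu_int// inv.
Qed.
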